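(* Let $\Bbbk$ be a field and write $H^*(-)=H^*(-;\Bbbk)$. Let $S^{n-1}\to S\to B$ be a spherical fibration $\xi$ with Thom space $M$, such that $M$ is simply connected, $H^*(B)$ has finite type, and $M$ has an orientation class $u\in H^n(M)$. Suppose that $u^2=0$. Then there is an isomorphism of Hopf algebras \[ \operatorname{Tor}^{*,*}_{H^*(M)}(\Bbbk,\Bbbk) = \mathrm{B}^*(H^*(M)), \] where $\mathrm{B}^*(H^*(M))$ denotes the bar construction with \[ \mathrm{B}^{-s}(H^*(M)) = (\tilde H^*(M))^{\otimes s}\qquad (s\geq 0), \] and the coproduct \[ \psi\colon\mathrm{B}^{-s}(H^*(M))\longrightarrow \bigoplus_{i=0}^s \mathrm{B}^{-i}(H^*(M))\otimes\mathrm{B}^{i-s}(H^*(M)) \] is the usual one, \[ \psi([u_1|\cdots|u_s]) = \sum_{i=0}^s\; [u_1|\cdots|u_i]\otimes[u_{i+1}|\cdots|u_s]. \]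
   Context: For a spherical fibration $\xi\colon S^{n-1}\to S\to B$ with associated disc bundle $D^n\to D\to B$, the Thom space is $M=M\xi=D/S$. An orientation class is a class $u\in \tilde H^n(M)$ for which the Thom map $H^*(B)\to\tilde H^{*+n}(M)$, $x\mapsto x\cdot u$, is an isomorphism, where $\cdot$ is the external product induced by the Thom diagonal $M\to B_+\wedge M$. Finite type means finite dimensional in each degree. The notation $\tilde H^*$ denotes reduced cohomology. Grading convention: $\operatorname{Tor}^{s,*}_{H^*(M)}=\operatorname{Tor}_{-s,*}^{H^*(M)}$ in the standard homological grading, so $s\le 0$; this is the $\mathrm{E}_2$-term of the Eilenberg-Moore spectral sequence converging to $H^*(\Omega M)$. Bar notation: $[w_1|\cdots|w_r]=w_1\otimes\cdots\otimes w_r$. All tensor products are over $\Bbbk$. The product on $\mathrm{B}^*(H^*(M))$ is the usual signed shuffle product, the sign being computed by giving each entry $w_i$ the shifted degree $\deg w_i+1$. *)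

(* Defs.v *)
From HB Require Import structures.
From mathcomp Require Import all_boot all_order all_algebra.
From mathcomp Require Import ring_quotient.
From mathcomp Require Import all_classical.
From mathcomp Require Import reals topology normedtype.
From mathcomp Require Import freeg.

Set Implicit Arguments.
Unset Strict Implicit.
Unset Printing Implicit Defensive.

Import Order.TTheory GRing.Theory Num.Theory.
Import numFieldNormedType.Exports.

Local Open Scope classical_set_scope.
Local Open Scope ring_scope.

(* ------------------------------------------------------------------------ *)
(* Subspaces, quotients and homology of vector spaces                       *)

Section Span.
Context {k : fieldType} {V : lmodType k}.
Implicit Types G : set V.

Definition span G : {pred V} := [pred v |
  `[< exists s : seq (k * V),
        (forall p, p \in s -> G p.2) /\ v = \sum_(p <- s) p.1 *: p.2 >]].

Lemma span_submod G : submod_closed (span G).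
Proof.
split; first by apply/asboolP; exists [::]; rewrite big_nil.
move=> a u v /asboolP[s [sG ->]] /asboolP[t [tG ->]]; apply/asboolP.
exists ([seq (a * p.1, p.2) | p <- s] ++ t); split.
  by move=> p; rewrite mem_cat => /orP[/mapP[q /sG Gq -> //]|/tG].
rewrite big_cat big_map /= scaler_sumr; congr (_ + _).
by apply: eq_bigr => p _; rewrite scalerA.
Qed.

HB.instance Definition _ G := GRing.isSubmodClosed.Build k V (span G)
  (span_submod G).

Record subspan G := SubSpan { subspan_val :> V; _ : subspan_val \in span G }.

HB.instance Definition _ G := [isSub for @subspan_val G].
HB.instance Definition _ G := [Choice of subspan G by <:].
HB.instance Definition _ G := [SubChoice_isSubLmodule of subspan G by <:].

Definition quotspan G : Type := Quotient.quot (span G).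

HB.instance Definition _ G := GRing.Zmodule.on (quotspan G).

Definition quotpi G (v : V) : quotspan G := \pi_(Quotient.quot (span G))%qT v.
Definition quotrep G (q : quotspan G) : V :=
  repr (q : Quotient.quot (span G)).

End Span.

Section Quotspan.
Context {k : fieldType} {V : lmodType k} (G : set V).

Lemma quotrepK (q : quotspan G) : quotpi G (quotrep q) = q.
Proof. exact: reprK. Qed.

Lemma quotpi_eqP (x y : V) :
  reflect (quotpi G x = quotpi G y) (x - y \in span G).
Proof.
rewrite (Quotient.idealrBE (span G) x y).
exact: (@eqP (Quotient.quot (span G))).
Qed.

Lemma quotpiD x y : quotpi G (x + y) = quotpi G x + quotpi G y.
Proof. exact: (raddfD (\pi_(Quotient.quot (span G)))%qT). Qed.

Definition quotscale (a : k) (q : quotspan G) : quotspan G :=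
  quotpi G (a *: quotrep q).

Lemma quotpi_scale a x : quotscale a (quotpi G x) = quotpi G (a *: x).
Proof.
apply/quotpi_eqP; rewrite -scalerBr; apply: rpredZ.
by apply/quotpi_eqP; rewrite quotrepK.
Qed.

Lemma quotscaleA a b q : quotscale a (quotscale b q) = quotscale (a * b) q.
Proof. by rewrite -(quotrepK q) !quotpi_scale scalerA. Qed.

Lemma quotscale1 : left_id 1 quotscale.
Proof. by move=> q; rewrite -(quotrepK q) quotpi_scale scale1r. Qed.

Lemma quotscaleDr : right_distributive quotscale +%R.
Proof.
move=> a q r; rewrite -(quotrepK q) -(quotrepK r) -quotpiD !quotpi_scale.
by rewrite scalerDr quotpiD.
Qed.

Lemma quotscaleDl q : {morph quotscale^~ q : a b / a + b}.
Proof.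
by move=> a b; rewrite -(quotrepK q) !quotpi_scale scalerDl quotpiD.
Qed.

HB.instance Definition _ := GRing.Zmodule_isLmodule.Build k (quotspan G)
  quotscaleA quotscale1 quotscaleDr quotscaleDl.

Lemma quotpi_is_linear : linear (quotpi G).
Proof. by move=> a x y; rewrite quotpiD -quotpi_scale. Qed.

HB.instance Definition _ :=
  GRing.isLinear.Build k V (quotspan G) _ (quotpi G) quotpi_is_linear.

End Quotspan.

(* The quotient Z / B of two subspaces of V, given by spanning sets with
   B contained in the span of Z.  [hclass z] is the class of z when z lies in
   the span of Z, and 0 otherwise. *)
Section Homology.
Context {k : fieldType} {V : lmodType k} (Z B : set V).

Definition homology : lmodType k :=
  quotspan [set z : subspan Z | B (val z)].

Definition hclass (z : V) : homology := quotpi _ (insubd (0 : subspan Z) z).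
Definition hrep (h : homology) : V := val (quotrep h).

End Homology.

(* ------------------------------------------------------------------------ *)
(* Tensor product of vector spaces                                          *)

Section Tensor.
Context {k : fieldType}.

Definition fgen (X : choiceType) (x : X) : {freeg X / k} := Freeg [:: (1, x)].

Definition bilinear_relators (U V : lmodType k) : set {freeg (U * V)%type / k} :=
  [set r | exists (a : k) (u u' : U) (v : V),
     r = fgen (a *: u + u', v) - a *: fgen (u, v) - fgen (u', v)] `|`
  [set r | exists (a : k) (u : U) (v v' : V),
     r = fgen (u, a *: v + v') - a *: fgen (u, v) - fgen (u, v')].

Definition tens (U V : lmodType k) : lmodType k :=
  quotspan (@bilinear_relators U V).

Definition pure {U V : lmodType k} (u : U) (v : V) : tens U V :=
  quotpi _ (fgen (u, v)).

(* The linear map on the tensor product determined by a bilinear [f] (which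
   makes the value independent of the representative). *)
Definition tens_lift {U V W : lmodType k} (f : U -> V -> W) (t : tens U V) : W :=
  fglift (fun p : (U * V)%type => f p.1 p.2) (quotrep t).

Definition tens_map {U U' V V' : lmodType k} (f : U -> U') (g : V -> V') :
  tens U V -> tens U' V' := tens_lift (fun u v => pure (f u) (g v)).

End Tensor.

(* ------------------------------------------------------------------------ *)
(* Singular cohomology with coefficients in k                               *)

Section Simplex.
Context (R : realType).

Definition simplex (n : nat) : topologicalType :=
  set_type [set t : 'rV[R]_n.+1 |
    (forall i, 0 <= t 0 i) /\ \sum_i t 0 i = 1].

Definition smap_fun {m n : nat} (f : 'I_m.+1 -> 'I_n.+1) (t : 'rV[R]_m.+1) :
  'rV[R]_n.+1 := \row_j \sum_(i | f i == j) t 0 i.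

Lemma smap_subproof {m n} (f : 'I_m.+1 -> 'I_n.+1) (t : simplex m) :
  smap_fun f (val t) \in [set t : 'rV[R]_n.+1 |
    (forall i, 0 <= t 0 i) /\ \sum_i t 0 i = 1].
Proof.
case: t => t /= /set_mem[t0 t1]; apply/mem_set; split=> [i|].
  by rewrite mxE; apply: sumr_ge0.
under eq_bigr do rewrite mxE.
by rewrite -t1 [RHS](partition_big f predT).
Qed.

(* The affine map of standard simplices given by [f] on the vertices. *)
Definition smap {m n} (f : 'I_m.+1 -> 'I_n.+1) (t : simplex m) : simplex n :=
  exist _ (smap_fun f (val t)) (smap_subproof f t).

Lemma smap_continuous {m n} (f : 'I_m.+1 -> 'I_n.+1) : continuous (smap f).
Proof.
apply: continuous_comp_initial.
rewrite (_ : _ \o _ = smap_fun f \o set_val) // => t.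
apply: continuous_comp; first exact: initial_continuous.
move=> A [P Pn PA].
suff Pt : nbhs (set_val t) [set z | forall i j, P i j (smap_fun f z i j)].
  by apply: filterS Pt => z /PA.
have allP (F : set_system 'rV[R]_m.+1) : Filter F ->
    (forall i j, F [set z | P i j (smap_fun f z i j)]) ->
    F [set z | forall i j, P i j (smap_fun f z i j)].
  move=> FF FP.
  apply: (@filter_forall _ _
    (fun i z => forall j, P i j (smap_fun f z i j))) => i.
  apply: (@filter_forall _ _ (fun j z => P i j (smap_fun f z i j))) => j.
  exact: FP.
apply: allP => i j.
have coord : (fun z => smap_fun f z i j) =
    (fun z : 'rV[R]_m.+1 => \sum_(l | f l == j) z 0 l).
  by apply/funext => z; rewrite mxE.
have cj : continuous (fun z => smap_fun f z i j).
  rewrite coord; apply: continuous_big => [x|l _]; last exact: coord_continuous.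
  exact: add_continuous.
exact: cj (Pn i j).
Qed.

HB.instance Definition _ m n (f : 'I_m.+1 -> 'I_n.+1) :=
  isContinuous.Build (simplex m) (simplex n) (smap f) (@smap_continuous m n f).

End Simplex.

Section Cohomology.
Context (R : realType) (k : fieldType).

Definition sing (n : nat) (X : topologicalType) : Type :=
  continuousType (simplex R n) X.

Definition cochain (n : nat) (X : topologicalType) : lmodType k :=
  sing n X -> k^o.

Definition restr {m n : nat} {X : topologicalType} (s : sing n X)
  (f : 'I_m.+1 -> 'I_n.+1) : sing m X :=
  [the continuousType (simplex R m) X of s \o smap f].

Definition coboundary {n : nat} {X : topologicalType} (phi : cochain n X) :
  cochain n.+1 X :=
  fun s => \sum_(i < n.+2) (-1) ^+ i * phi (restr s (fintype.lift i)).

Definition cocycles (n : nat) (X : topologicalType) : set (cochain n X) :=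
  [set phi | coboundary phi = 0].

Definition coboundaries (n : nat) (X : topologicalType) : set (cochain n X) :=
  match n with
  | 0 => [set 0]
  | m.+1 => range (@coboundary m X)
  end.

Definition cohom (n : nat) (X : topologicalType) : lmodType k :=
  homology (@cocycles n X) (@coboundaries n X).

Definition cohclass {n : nat} {X : topologicalType} (phi : cochain n X) :
  cohom n X := hclass _ _ phi.

Definition cohrep {n : nat} {X : topologicalType} (v : cohom n X) :
  cochain n X := hrep v.

Definition cup_cochain {p q : nat} {X : topologicalType}
  (phi : cochain p X) (psi : cochain q X) : cochain (p + q) X :=
  fun s => phi (restr s (fun i : 'I_p.+1 => inord i)) *
           psi (restr s (fun i : 'I_q.+1 => inord (p + i))).

Definition cup {p q : nat} {X : topologicalType}
  (v : cohom p X) (w : cohom q X) : cohom (p + q) X :=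
  cohclass (cup_cochain (cohrep v) (cohrep w)).

Definition coh1 {X : topologicalType} : cohom 0 X := cohclass (fun=> 1).

Definition pullback {X Y : topologicalType} (f : continuousType X Y) {n : nat}
  (v : cohom n Y) : cohom n X :=
  cohclass (fun s : sing n X =>
    cohrep v [the continuousType (simplex R n) Y of f \o s]).

Definition finite_type_cohom (X : topologicalType) : Prop :=
  forall n, exists (m : nat) (e : 'I_m -> cohom n X),
    forall v, exists a : 'I_m -> k, v = \sum_i a i *: e i.

End Cohomology.

(* The inclusion of the base point. *)
Definition incl_point (X : ptopologicalType) : set_type [set point : X] -> X :=
  set_val.

Lemma incl_point_continuous (X : ptopologicalType) :
  continuous (@incl_point X).
Proof. exact: initial_continuous. Qed.

HB.instance Definition _ (X : ptopologicalType) :=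
  isContinuous.Build _ _ (@incl_point X) (@incl_point_continuous X).

(* Reduced cohomology, as the kernel of the restriction to the base point. *)
Definition reduced (R : realType) (k : fieldType) (X : ptopologicalType)
  (n : nat) : set (cohom R k n X) := [set v | pullback (@incl_point X) v = 0].

(* ------------------------------------------------------------------------ *)
(* Spherical fibrations and Thom spaces                                     *)

(* X / A with the quotient topology; [None] is the point A, so that
   X / set0 is X with a disjoint base point. *)
Section Collapse.
Context {X : topologicalType} (A : set X).

Definition collapse : Type := option (set_type (~` A)).

HB.instance Definition _ := Choice.on collapse.

Definition collapse_pi (x : X) : collapse := insub x.

Definition collapse_open (U : set collapse) := open (collapse_pi @^-1` U).

Lemma collapse_openT : collapse_open setT.
Proof. exact: openT. Qed.

Lemma collapse_openI : setI_closed collapse_open.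
Proof. by move=> U V; exact: openI. Qed.

Lemma collapse_open_bigU (I : Type) (F : I -> set collapse) :
  (forall i, collapse_open (F i)) -> collapse_open (\bigcup_i F i).
Proof. by move=> oF; apply: bigcup_open => i _; exact: oF. Qed.

HB.instance Definition _ := isOpenTopological.Build collapse
  collapse_openT collapse_openI collapse_open_bigU.
HB.instance Definition _ := isPointed.Build collapse None.

Lemma collapse_pi_continuous : continuous collapse_pi.
Proof. exact/continuousP. Qed.

HB.instance Definition _ :=
  isContinuous.Build X collapse collapse_pi collapse_pi_continuous.

End Collapse.

Section Fibrations.
Context (R : realType).

Definition unit_interval : topologicalType := set_type [set t : R | 0 <= t <= 1].

Lemma i0_subproof : (0 : R) \in [set t : R | 0 <= t <= 1].
Proof. by apply/mem_set; rewrite /= lexx ler01. Qed.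

Lemma i1_subproof : (1 : R) \in [set t : R | 0 <= t <= 1].
Proof. by apply/mem_set; rewrite /= lexx ler01. Qed.

Definition i0 : unit_interval := exist _ 0 i0_subproof.
Definition i1 : unit_interval := exist _ 1 i1_subproof.

Definition homotopic {X Y : topologicalType} (f g : X -> Y) : Prop :=
  exists h : X * unit_interval -> Y, [/\ continuous h,
    forall x, h (x, i0) = f x & forall x, h (x, i1) = g x].

Definition homotopy_equivalent (X Y : topologicalType) : Prop :=
  exists (f : X -> Y) (g : Y -> X), [/\ continuous f, continuous g,
    homotopic (g \o f) idfun & homotopic (f \o g) idfun].

Definition simply_connected (X : topologicalType) : Prop :=
  (exists x : X, True) /\
  (forall x y : X, exists g : unit_interval -> X,
     [/\ continuous g, g i0 = x & g i1 = y]) /\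
  (forall g : unit_interval -> X, continuous g -> g i0 = g i1 ->
     exists h : unit_interval * unit_interval -> X, [/\ continuous h,
       forall s, h (s, i0) = g s, forall s, h (s, i1) = g i0,
       forall t, h (i0, t) = g i0 & forall t, h (i1, t) = g i0]).

Definition hurewicz_fibration {S B : topologicalType} (p : S -> B) : Prop :=
  forall (Y : topologicalType) (f : Y -> S) (h : Y * unit_interval -> B),
    continuous f -> continuous h -> (forall y, h (y, i0) = p (f y)) ->
    exists H : Y * unit_interval -> S, [/\ continuous H,
      forall y, H (y, i0) = f y & forall z, p (H z) = h z].

(* The unit sphere S^(n-1) of R^n (empty for n = 0). *)
Definition sphere (n : nat) : topologicalType :=
  set_type [set x : 'rV[R]_n | \sum_i x 0 i ^+ 2 = 1].

Definition spherical_fibration (n : nat) {S B : topologicalType}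
  (p : continuousType S B) : Prop :=
  hurewicz_fibration p /\
  forall b, homotopy_equivalent (set_type (p @^-1` [set b])) (sphere n).

(* The disc bundle associated with p : S -> B is its mapping cylinder, i.e. the
   fibrewise cone, (S * [0, 1] + B) / ((s, 0) ~ p s), whose points are those of
   B and the (s, t) with t <> 0.  S is embedded in it as the (s, 1). *)
Section Disc.
Context {S B : topologicalType} (p : continuousType S B).

Definition disc : Type :=
  (B + set_type [set z : S * unit_interval | z.2 <> i0])%type.

HB.instance Definition _ := Choice.on disc.

Definition disc_base (b : B) : disc := inl b.
Definition disc_cone (z : S * unit_interval) : disc :=
  if insub z is Some z' then inr z' else inl (p z.1).

Definition disc_open (U : set disc) :=
  open (disc_base @^-1` U) /\ open (disc_cone @^-1` U).

Lemma disc_openT : disc_open setT.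
Proof. by split; exact: openT. Qed.

Lemma disc_openI : setI_closed disc_open.
Proof. by move=> U V [? ?] [? ?]; split; exact: openI. Qed.

Lemma disc_open_bigU (I : Type) (F : I -> set disc) :
  (forall i, disc_open (F i)) -> disc_open (\bigcup_i F i).
Proof.
by move=> oF; split; apply: bigcup_open => i _; have [] := oF i.
Qed.

HB.instance Definition _ := isOpenTopological.Build disc
  disc_openT disc_openI disc_open_bigU.

Definition disc_proj (d : disc) : B :=
  match d with inl b => b | inr z => p (val z).1 end.

Lemma disc_proj_continuous : continuous disc_proj.
Proof.
apply/continuousP => U oU; split; first exact: oU.
rewrite (_ : _ @^-1` _ = (p \o fst) @^-1` U).
  apply: open_comp => // z _; apply: continuous_comp; first exact: cvg_fst.
  exact: cts_fun.
by apply/funext => z /=; rewrite /disc_cone; case: insubP => //= u _ ->.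
Qed.

Definition disc_sphere : set disc := [set disc_cone (s, i1) | s in setT].

Definition thom_space : ptopologicalType := collapse disc_sphere.

(* B_+ /\ M, i.e. (B * M) / (B * {base point}). *)
Definition smash_base : set (B * thom_space) := [set z | z.2 = point].
Definition smash : ptopologicalType := collapse smash_base.

Definition thom_diag (m : thom_space) : smash :=
  match m with
  | None => point
  | Some d => collapse_pi smash_base (disc_proj (val d), m)
  end.

Lemma thom_diag_continuous : continuous thom_diag.
Proof.
apply/continuousP => U oU.
rewrite /open/= /collapse_open -comp_preimage.
rewrite (_ : thom_diag \o _ =
  collapse_pi smash_base \o (fun d => (disc_proj d, collapse_pi disc_sphere d))).
  apply: open_comp => // d _; apply: continuous_comp; last first.
    exact: collapse_pi_continuous.
  exact: (cvg_pair (@disc_proj_continuous d)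
    (@collapse_pi_continuous _ disc_sphere d)).
apply/funext => d /=; rewrite {1 3}/collapse_pi.
case: insubP => [u _ <- //=|nd /=].
rewrite /collapse_pi insubN //; apply/negP => /set_mem; apply.
by rewrite /smash_base /=.
Qed.

HB.instance Definition _ :=
  isContinuous.Build thom_space smash thom_diag thom_diag_continuous.

End Disc.

End Fibrations.

Section Projections.
Context {X Y : topologicalType}.

Definition pr1 : X * Y -> X := fst.
Definition pr2 : X * Y -> Y := snd.

Lemma pr1_continuous : continuous pr1. Proof. by move=> z; exact: cvg_fst. Qed.
Lemma pr2_continuous : continuous pr2. Proof. by move=> z; exact: cvg_snd. Qed.

HB.instance Definition _ := isContinuous.Build _ _ pr1 pr1_continuous.
HB.instance Definition _ := isContinuous.Build _ _ pr2 pr2_continuous.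

End Projections.

Section Orientation.
Context (R : realType) (k : fieldType) {S B : topologicalType}
  (p : continuousType S B).

Local Notation M := (thom_space R p).

(* [w] is the external product of x in H^*(B) and u in reduced H^*(M): the
   class in the reduced cohomology of B_+ /\ M that pulls back to the cross
   product of x and u on B * M. *)
Definition external_product {i n : nat} (x : cohom R k i B)
  (u : cohom R k n M) (w : cohom R k (i + n) (smash R p)) : Prop :=
  reduced w /\
  pullback (collapse_pi (@smash_base R S B p)) w =
    cup (pullback (@pr1 B M) x) (pullback (@pr2 B M) u).

(* The graph of the Thom map x |-> x . u. *)
Definition thom_map {i n : nat} (u : cohom R k n M) (x : cohom R k i B)
  (v : cohom R k (i + n) M) : Prop :=
  exists2 w, external_product x u w & v = pullback (@thom_diag R S B p) w.

(* The Thom map H^i(B) -> reduced H^(i + n)(M) is an isomorphism for every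
   integer i; for negative i this says that reduced H^j(M) = 0 for j < n. *)
Definition orientation_class {n : nat} (u : cohom R k n M) : Prop :=
  [/\ reduced u,
      forall i (x : cohom R k i B), exists! v, thom_map u x v,
      forall i (v : cohom R k (i + n) M), reduced v ->
        exists! x : cohom R k i B, thom_map u x v &
      forall j (v : cohom R k j M), (j < n)%N -> reduced v -> v = 0].

End Orientation.

(* ------------------------------------------------------------------------ *)
(* Bigraded Hopf algebras                                                   *)

(* The structure maps of a bigraded Hopf algebra.  [hopf_deg s t] is the part
   of homological degree s and internal degree t, i.e. of bidegree (-s, t). *)
Record hopf_data (k : fieldType) := HopfData {
  hopf_sort :> lmodType k;
  hopf_deg : nat -> nat -> set hopf_sort;
  hopf_one : hopf_sort;
  hopf_mul : hopf_sort -> hopf_sort -> hopf_sort;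
  hopf_counit : hopf_sort -> k;
  hopf_comul : hopf_sort -> tens hopf_sort hopf_sort }.

Arguments hopf_deg {k} _ _ _.
Arguments hopf_one {k} _.
Arguments hopf_mul {k} _ _ _.
Arguments hopf_counit {k} _ _.
Arguments hopf_comul {k} _ _.

(* Compatibility with the antipodes is automatic. *)
Definition hopf_isomorphic {k : fieldType} (H K : hopf_data k) : Prop :=
  exists phi : {linear H -> K},
    bijective phi /\
    (forall s t, phi @` hopf_deg H s t = hopf_deg K s t) /\
    phi (hopf_one H) = hopf_one K /\
    (forall x y, phi (hopf_mul H x y) = hopf_mul K (phi x) (phi y)) /\
    (forall x, hopf_counit K (phi x) = hopf_counit H x) /\
    (forall x, hopf_comul K (phi x) = tens_map phi phi (hopf_comul H x)).

Record dg_hopf_data (k : fieldType) := DgHopfData {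
  dg_hopf :> hopf_data k;
  dg_diff : dg_hopf -> dg_hopf;
  (* multiplication by (-1)^(total degree) *)
  dg_sign : dg_hopf -> dg_hopf }.

Arguments dg_diff {k} _ _.
Arguments dg_sign {k} _ _.

(* The homology of a differential graded Hopf algebra, with the structure maps
   induced through the Kuenneth isomorphism H(D) (x) H(D) = H(D (x) D). *)
Section HomologyHopf.
Context {k : fieldType} (D : dg_hopf_data k).

Definition dg_cycles : set D := [set x | dg_diff D x = 0].
Definition dg_boundaries : set D := range (dg_diff D).

Definition dg_homology : lmodType k := homology dg_cycles dg_boundaries.

Definition dg_class (x : D) : dg_homology := hclass dg_cycles dg_boundaries x.

Definition tens_diff : tens D D -> tens D D :=
  tens_lift (fun x y : D =>
    pure (dg_diff D x) y + pure (dg_sign D x) (dg_diff D y)).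

Definition comul_homology_graph (h : dg_homology) :
    set (tens dg_homology dg_homology) :=
  [set t | exists s : seq (D * D)%type,
     [/\ forall q, q \in s -> dg_cycles q.1 /\ dg_cycles q.2,
         range tens_diff
           (hopf_comul D (hrep h) - \sum_(q <- s) pure q.1 q.2) &
         t = \sum_(q <- s) pure (dg_class q.1) (dg_class q.2)]].

Definition homology_hopf : hopf_data k := {|
  hopf_sort := dg_homology;
  hopf_deg := fun s t => dg_class @` (hopf_deg D s t `&` dg_cycles);
  hopf_one := dg_class (hopf_one D);
  hopf_mul := fun h h' => dg_class (hopf_mul D (hrep h) (hrep h'));
  hopf_counit := fun h => hopf_counit D (hrep h);
  hopf_comul := fun h => xget 0 (comul_homology_graph h) |}.

End HomologyHopf.

(* ------------------------------------------------------------------------ *)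
(* The bar construction and Tor for the augmented algebra H^*(X)            *)

Section Bar.
Context (R : realType) (k : fieldType) (X : ptopologicalType).

(* Homogeneous elements of H^*(X) and of its augmentation ideal. *)
Definition helt : choiceType := {i : nat & cohom R k i X}.
Definition redcohom (i : nat) : lmodType k := subspan (@reduced R k X i).
Definition rhelt : choiceType := {i : nat & redcohom i}.

Definition helt_of (x : rhelt) : helt :=
  Tagged (fun i => cohom R k i X) (val (tagged x)).

Definition helt_one : helt := Tagged (fun i => cohom R k i X) (coh1 R k (X:=X)).

Definition helt_mul (a b : helt) : helt :=
  Tagged (fun i => cohom R k i X) (cup (tagged a) (tagged b)).

Definition rhelt_mul (x y : rhelt) : rhelt :=
  Tagged redcohom (insubd (0 : redcohom (tag x + tag y))
    (cup (val (tagged x)) (val (tagged y)))).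

(* The word [x_1; ...; x_s] stands for [x_1 | ... | x_s]; each entry counts with
   its degree plus one in the signs. *)
Definition word : choiceType := seq rhelt.

Definition rhelt_deg (x : rhelt) : nat := tag x.
Definition word_deg (w : word) : nat := sumn (map rhelt_deg w).
Definition word_sdeg (w : word) : nat := sumn (map (fun x => (rhelt_deg x).+1) w).

(* The direct sum over s of the s-fold tensor powers of the reduced cohomology:
   words modulo linearity in each entry. *)
Definition word_relators : set {freeg word / k} :=
  [set r | exists (w w' : word) (i : nat) (a : k) (x y : redcohom i),
     r = fgen (w ++ Tagged redcohom (a *: x + y) :: w')
         - a *: fgen (w ++ Tagged redcohom x :: w')
         - fgen (w ++ Tagged redcohom y :: w')].

Definition bar : lmodType k := quotspan word_relators.

Definition bar_word (w : word) : bar := quotpi _ (fgen w).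

(* The linear map with value [f w] on [bar_word w], for f linear in each
   entry (which makes the value independent of the representative). *)
Definition bar_lift {W : lmodType k} (f : word -> W) (z : bar) : W :=
  fglift f (quotrep z).

(* The shuffles of two words, each with the exponent of its sign. *)
Fixpoint shuffles (u : word) : word -> seq (nat * word) :=
  match u with
  | [::] => fun v => [:: (0, v)]
  | x :: u' => fix shuffles_x (v : word) : seq (nat * word) :=
      match v with
      | [::] => [:: (0, u)]
      | y :: v' =>
          [seq (q.1, x :: q.2) | q <- shuffles u' v] ++
          [seq ((q.1 + (rhelt_deg y).+1 * word_sdeg u)%N, y :: q.2)
             | q <- shuffles_x v']
      end
  end.

Definition bar_mul (z z' : bar) : bar :=
  bar_lift (fun u => bar_lift (fun v =>
    \sum_(q <- shuffles u v) (-1) ^+ q.1 *: bar_word q.2) z') z.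

Definition bar_comul : bar -> tens bar bar :=
  bar_lift (fun w =>
    \sum_(i < (size w).+1) pure (bar_word (take i w)) (bar_word (drop i w))).

Definition bar_counit : bar -> k :=
  bar_lift (fun w => (w == [::])%:R : k^o).

Definition bar_deg (s t : nat) : set bar :=
  [set z | z \in span [set bar_word w | w in
                         [set w : word | size w = s /\ word_deg w = t]]].

Definition bar_sign : bar -> bar :=
  bar_lift (fun w => (-1) ^+ word_sdeg w *: bar_word w).

Definition bar_hopf : hopf_data k := {|
  hopf_sort := bar;
  hopf_deg := bar_deg;
  hopf_one := bar_word [::];
  hopf_mul := bar_mul;
  hopf_counit := bar_counit;
  hopf_comul := bar_comul |}.

(* The bar resolution A (x) B(A) of k by free modules over A = H^*(X), spanned
   by the a [x_1 | ... | x_s], and its differential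
     d (a [x_1 | ... | x_s]) = (-1)^|a| a x_1 [x_2 | ... | x_s]
       + \sum_(0 < i < s) (-1)^(e_i) a [x_1 | ... | x_i x_(i+1) | ... | x_s],
   where e_i = |a| + (|x_1| + 1) + ... + (|x_i| + 1).  The terms of the sum are
   listed by [contractions] with their e_i. *)
Definition bar_gen : choiceType := (helt * word)%type.

Fixpoint contractions (e : nat) (w : word) : seq (nat * word) :=
  match w with
  | x :: ((y :: v) as w') =>
      ((e + (rhelt_deg x).+1)%N, rhelt_mul x y :: v) ::
      [seq (q.1, x :: q.2) | q <- contractions (e + (rhelt_deg x).+1) w']
  | _ => [::]
  end.

Definition bar_res_diff_gen (g : bar_gen) : {freeg bar_gen / k} :=
  (if g.2 is x :: w then
     (-1) ^+ tag g.1 *: fgen (helt_mul g.1 (helt_of x), w) else 0) +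
  \sum_(q <- contractions (tag g.1) g.2) (-1) ^+ q.1 *: fgen (g.1, q.2).

Definition bar_res_relators : set {freeg bar_gen / k} :=
  [set r | exists (i : nat) (c : k) (a b : cohom R k i X) (w : word),
     let t (e : cohom R k i X) := Tagged (fun i => cohom R k i X) e : helt in
     r = fgen (t (c *: a + b), w) - c *: fgen (t a, w) - fgen (t b, w)] `|`
  [set r | exists (a : helt) (w w' : word) (i : nat) (c : k) (x y : redcohom i),
     r = fgen (a, w ++ Tagged redcohom (c *: x + y) :: w')
         - c *: fgen (a, w ++ Tagged redcohom x :: w')
         - fgen (a, w ++ Tagged redcohom y :: w')].

(* The action of the augmentation ideal, to be divided out in k (x)_A -. *)
Definition augmentation_relators : set {freeg bar_gen / k} :=
  [set r | exists (b : rhelt) (a : helt) (w : word),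
     r = fgen (helt_mul (helt_of b) a, w)].

(* The complex k (x)_A (A (x) B(A)).  Its elements are the images of the
   1 [x_1 | ... | x_s], through which it acquires the shuffle product and the
   coproduct of the bar construction. *)
Definition bar_cpx : lmodType k :=
  quotspan (bar_res_relators `|` augmentation_relators).

Definition bar_cpx_diff (c : bar_cpx) : bar_cpx :=
  quotpi _ (fglift bar_res_diff_gen (quotrep c)).

Definition bar_to_cpx : bar -> bar_cpx :=
  bar_lift (fun w => quotpi _ (fgen (helt_one, w)) : bar_cpx).

Definition cpx_to_bar (c : bar_cpx) : bar := xget 0 [set z | bar_to_cpx z = c].

Definition bar_cpx_hopf : hopf_data k := {|
  hopf_sort := bar_cpx;
  hopf_deg := fun s t => bar_to_cpx @` bar_deg s t;
  hopf_one := bar_to_cpx (hopf_one bar_hopf);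
  hopf_mul := fun c c' =>
    bar_to_cpx (hopf_mul bar_hopf (cpx_to_bar c) (cpx_to_bar c'));
  hopf_counit := fun c => hopf_counit bar_hopf (cpx_to_bar c);
  hopf_comul := fun c =>
    tens_map bar_to_cpx bar_to_cpx (hopf_comul bar_hopf (cpx_to_bar c)) |}.

Definition bar_cpx_dg_hopf : dg_hopf_data k := {|
  dg_hopf := bar_cpx_hopf;
  dg_diff := bar_cpx_diff;
  dg_sign := fun c => bar_to_cpx (bar_sign (cpx_to_bar c)) |}.

(* Tor_{H^*(X)}(k, k). *)
Definition Tor_hopf : hopf_data k := homology_hopf bar_cpx_dg_hopf.

End Bar.

(* Main.v *)
Require Import Defs.
From HB Require Import structures.
From mathcomp Require Import all_boot all_order all_algebra.
From mathcomp Require Import all_classical.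
From mathcomp Require Import reals topology.
From mathcomp Require Import freeg ring zify.
Import Defs.

(* Topology: the product of two classes of reduced H^*(M) vanishes.  By the Thom
   isomorphism they are pulled back along the Thom diagonal from classes w, w'
   which become x u and y u in H^*(B * M), so w w' becomes x u y u = +- x y u u,
   which is 0.  The Thom map takes a unique value at 0, hence w w' pulls back to
   0 on M; this replaces the injectivity of H^*(B_+ /\ M) -> H^*(B * M), for
   which one would need excision.  Graded commutativity of the cup product comes
   from the homotopy between the identity and the reversal of vertices.

   Algebra: when these products vanish, so does the differential of
   k (x)_A (A (x) B(A)) for A = H^*(M), which is then its own homology; it is
   identified with B(A) by the augmentation A -> k. *)

Set Implicit Arguments.
Unset Strict Implicit.
Unset Printing Implicit Defensive.

Import Order.TTheory GRing.Theory Num.Theory.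

Local Open Scope classical_set_scope.
Local Open Scope ring_scope.

(** * Free modules, quotients and tensor products *)

(** Serves maps such as [cup v] and [pullback f], whose linearity is only known as a property of a
    bare function. *)
Lemma linear_fun0 (k : fieldType) (U V : lmodType k) (f : U -> V) :
  linear f -> f 0 = 0.
Proof. by move=> fP; have := fP (-1) 0 0; rewrite !scaleN1r !addNr. Qed.

Section FreeModules.
Context {k : fieldType} {X : choiceType} {W : lmodType k}.
Implicit Types (f : X -> W) (D : {freeg X / k}).

Lemma freeg_ind (P : {freeg X / k} -> Prop) :
  P 0 -> (forall a x D, P D -> P (a *: fgen x + D)) -> forall D, P D.
Proof.
move=> P0 PS D; rewrite -(Freeg_enum D); elim: (fgenum D) => [|[a x] s IH].
  by rewrite freeg_nil.
rewrite -cat1s freeg_cat (_ : Freeg [:: (a, x)] = a *: fgen x); first exact: PS.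
by apply/eqP/freeg_eqP => y; rewrite coeffZ !coeffU mul1r.
Qed.

Lemma fglift_is_linear f : linear (fglift f).
Proof.
have fgliftB D E : fglift f (D - E) = fglift f D - fglift f E.
  exact: lift_is_additive.
have fglift0 : fglift f 0 = 0 by have := fgliftB 0 0; rewrite !subrr.
have fgliftD D E : fglift f (D + E) = fglift f D + fglift f E.
  by rewrite -{1}(opprK E) fgliftB -(sub0r E) fgliftB fglift0 sub0r opprK.
move=> a D E; rewrite fgliftD; congr (_ + _).
elim/freeg_ind: D => [|b x D IH]; first by rewrite !scaler0 fglift0 scaler0.
rewrite scalerDr !fgliftD IH scalerDr; congr (_ + _).
have fgE c : c *: fgen x = Freeg [:: (c, x)] :> {freeg X / k}.
  by apply/eqP/freeg_eqP => y; rewrite coeffZ !coeffU mul1r.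
by rewrite scalerA !fgE !liftU scalerA.
Qed.

HB.instance Definition _ f :=
  GRing.isLinear.Build k {freeg X / k} W _ (fglift f) (fglift_is_linear f).

Lemma fglift_fgen f x : fglift f (fgen x) = f x.
Proof. by rewrite liftU scale1r. Qed.

End FreeModules.

Section Quotients.
Context {k : fieldType} {V : lmodType k}.
Implicit Types G : set V.

Lemma mem_span G v : G v -> v \in span G.
Proof.
move=> Gv; apply/asboolP; exists [:: (1, v)]; rewrite big_seq1 scale1r.
by split=> // p; rewrite inE => /eqP->.
Qed.

Lemma linear_span_eq0 {W : lmodType k} (h : {linear V -> W}) G :
  (forall v, G v -> h v = 0) -> forall v, v \in span G -> h v = 0.
Proof.
move=> hG v /asboolP[s [sG ->]]; rewrite linear_sum big_seq big1 // => p /sG Gp.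
by rewrite linearZ /= hG // scaler0.
Qed.

Lemma quotpi_eq0 G v : v \in span G -> quotpi G v = 0.
Proof.
by move=> Gv; rewrite -(linear0 (quotpi G)); apply/quotpi_eqP; rewrite subr0.
Qed.

Section Lift.
Context {W : lmodType k} (h : {linear V -> W}) (G : set V).
Hypothesis hG : forall v, G v -> h v = 0.

(** Two representatives of a class differ by an element of [span G], which [h] kills. This makes
    [tens_lift], [bar_lift] and [cpx_aug], all defined through the arbitrary choice [quotrep], well
    defined. *)
Lemma quotrep_lift v : h (quotrep (quotpi G v)) = h v.
Proof.
apply/eqP; rewrite -subr_eq0 -linearB; apply/eqP/(linear_span_eq0 hG).
by apply/quotpi_eqP; rewrite quotrepK.
Qed.

Lemma quotrep_lift_linear : linear (h \o quotrep (G := G)).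
Proof.
move=> a x y /=; rewrite -(quotrepK x) -(quotrepK y) -linearP.
by rewrite !quotrep_lift linearP.
Qed.

End Lift.

End Quotients.

Section TensorProducts.
Context {k : fieldType}.

Definition bilin {U V W : lmodType k} (f : U -> V -> W) :=
  (forall v, linear (f^~ v)) /\ (forall u, linear (f u)).

Section Lift.
Context {U V W : lmodType k} {f : U -> V -> W}.
Hypothesis bf : bilin f.

Let lf := fglift (fun p : U * V => f p.1 p.2).

Let lf_relators r : bilinear_relators r -> lf r = 0.
Proof.
case: bf => [fl fr]; case=> -[a [x [y [z ->]]]];
  by rewrite /lf !linearB linearZ /= !fglift_fgen /= ?fl ?fr addrAC addrK subrr.
Qed.

Lemma tens_lift_pure u v : tens_lift f (pure u v) = f u v.
Proof. by rewrite /tens_lift (quotrep_lift lf_relators) /= fglift_fgen. Qed.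

Lemma tens_lift_linear : linear (tens_lift f).
Proof. exact: quotrep_lift_linear lf_relators. Qed.

End Lift.

Lemma pure_bilin {U V : lmodType k} : bilin (@pure k U V).
Proof.
split=> [v a x y|u a x y].
  apply/eqP; rewrite -subr_eq0 opprD addrA -linearZ -!linearB.
  apply/eqP/quotpi_eq0/mem_span; left.
  by exists a, x, y, v.
apply/eqP; rewrite -subr_eq0 opprD addrA -linearZ -!linearB.
apply/eqP/quotpi_eq0/mem_span; right.
by exists a, u, x, y.
Qed.

(** No coefficients are needed, as a scalar is absorbed by the first factor. *)
Lemma tens_sum_pure {U V : lmodType k} (t : tens U V) :
  exists s : seq (U * V), t = \sum_(q <- s) pure q.1 q.2.
Proof.
rewrite -(quotrepK t).
elim/(@freeg_ind k (U * V)%type): (quotrep t) => [|a [u v] D [s IH]].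
  by exists [::]; rewrite big_nil linear0.
exists ((a *: u, v) :: s); rewrite big_cons -IH linearP; congr (_ + _).
have [/(_ v a u 0)] := @pure_bilin U V.
rewrite addr0 => -> _.
suff -> : pure 0 v = 0 :> tens U V by rewrite addr0.
have [/(_ v 1 0 0) + _] := @pure_bilin U V.
rewrite scaler0 scale1r addr0 => /(congr1 (+%R (- pure 0 v))).
by rewrite addKr addNr.
Qed.

Lemma tens_map_bilin {U U' V V' : lmodType k}
    (f : {linear U -> U'}) (g : {linear V -> V'}) :
  bilin (fun u v => pure (f u) (g v)).
Proof.
have [pl pr] := @pure_bilin U' V'.
by split=> [v a x y|u a x y]; rewrite linearP ?pl ?pr.
Qed.

Lemma tens_map_pure {U U' V V' : lmodType k}
    (f : {linear U -> U'}) (g : {linear V -> V'}) u v :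
  tens_map f g (pure u v) = pure (f u) (g v).
Proof. exact/tens_lift_pure/tens_map_bilin. Qed.

Lemma tens_map_linear {U U' V V' : lmodType k}
    (f : {linear U -> U'}) (g : {linear V -> V'}) : linear (tens_map f g).
Proof. exact/tens_lift_linear/tens_map_bilin. Qed.

HB.instance Definition _ {U U' V V' : lmodType k}
    (f : {linear U -> U'}) (g : {linear V -> V'}) :=
  GRing.isLinear.Build k (tens U V) (tens U' V') _ (tens_map f g)
    (tens_map_linear f g).

Lemma tens_map_sum_pure {U U' V V' : lmodType k}
    (f : {linear U -> U'}) (g : {linear V -> V'}) (s : seq (U * V)) :
  tens_map f g (\sum_(q <- s) pure q.1 q.2) =
  \sum_(q <- s) pure (f q.1) (g q.2).
Proof. by rewrite linear_sum; apply: eq_bigr => q _; exact: tens_map_pure. Qed.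

Lemma tens_map_comp {U U' U'' V V' V'' : lmodType k}
    (f' : {linear U' -> U''}) (g' : {linear V' -> V''})
    (f : {linear U -> U'}) (g : {linear V -> V'}) (t : tens U V) :
  tens_map f' g' (tens_map f g t) = tens_map (f' \o f) (g' \o g) t.
Proof.
have [s ->] := tens_sum_pure t; rewrite !tens_map_sum_pure linear_sum.
by apply: eq_bigr => q _; exact: tens_map_pure.
Qed.

Lemma tens_map_id {U V : lmodType k} (t : tens U V) :
  tens_map idfun idfun t = t.
Proof. by have [s ->] := tens_sum_pure t; rewrite tens_map_sum_pure. Qed.

End TensorProducts.

Definition subspace {k : fieldType} {V : lmodType k} (Z : set V) :=
  Z 0 /\ forall a x y, Z x -> Z y -> Z (a *: x + y).

(** [homology] is defined from spanning sets. Cocycles and coboundaries are already subspaces, so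
    membership in a span reduces to membership in the set. *)
Lemma subspace_span {k : fieldType} {V : lmodType k} (Z : set V) :
  subspace Z -> forall v, v \in span Z -> Z v.
Proof.
move=> [Z0 ZP] v /asboolP[s [sZ ->]].
elim: s sZ => [|p s IH] sZ; first by rewrite big_nil.
rewrite big_cons; apply: ZP; first by apply: sZ; rewrite mem_head.
by apply: IH => q qs; apply: sZ; rewrite in_cons qs orbT.
Qed.

(** * Classes and representatives in a subquotient *)

Section HomologyTheory.
Context {k : fieldType} {V : lmodType k} (Z B : set V).
Hypotheses (subZ : subspace Z) (subB : subspace B).

Lemma hrep_cycle (h : homology Z B) : Z (hrep h).
Proof. exact: subspace_span subZ _ (valP (quotrep h)). Qed.

Lemma hrepK (h : homology Z B) : hclass Z B (hrep h) = h.
Proof. by rewrite /hclass valKd quotrepK. Qed.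

Lemma insubd_cycle z : Z z -> val (insubd (0 : subspan Z) z) = z.
Proof. by move=> Zz; rewrite insubdK //; apply: mem_span. Qed.

Lemma hclass_linear a x y : Z x -> Z y ->
  hclass Z B (a *: x + y) = a *: hclass Z B x + hclass Z B y.
Proof.
move=> Zx Zy; rewrite /hclass -linearP; congr quotpi; apply: val_inj.
rewrite linearP /= !insubd_cycle //; exact: subZ.2.
Qed.

Lemma hclass_eqP x y : Z x -> Z y ->
  hclass Z B x = hclass Z B y <-> B (x - y).
Proof.
have sub : subspace [set z : subspan Z | B (val z)].
  split=> [|a u v Bu Bv]; first by rewrite /mkset linear0; exact: subB.1.
  by rewrite /mkset linearP; apply: subB.2.
move=> Zx Zy; split=> [/quotpi_eqP/(subspace_span sub)|Bxy].
  by rewrite /mkset linearB /= !insubd_cycle.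
by apply/quotpi_eqP/mem_span; rewrite /mkset linearB /= !insubd_cycle.
Qed.

Lemma hclass_eq0P x : Z x -> hclass Z B x = 0 <-> B x.
Proof.
move=> Zx; have Z0 := subZ.1; have B0 := subB.1.
have h0 : hclass Z B 0 = 0.
  by have := hclass_linear (-1) Z0 Z0; rewrite !scaleN1r !addNr.
by rewrite -[in X in X <-> _]h0 hclass_eqP // subr0.
Qed.

End HomologyTheory.

(** * Cochains on lists of vertices *)

(* A function on lists is a cochain on the ordered simplices with the given
   vertices, the empty list being the simplex of dimension -1. *)
Section ListCochains.
Context {k : fieldType} {T : Type}.
Implicit Types (F G : seq T -> k) (l t : seq T) (v : T).

Definition pcons F v : seq T -> k := fun t => F (v :: t).
Definition prcons F v : seq T -> k := fun t => F (rcons t v).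

(** The augmented simplicial coboundary, an alternating sum over deleted vertices (see [lbd_sum]).
    The recursion separates the face opposite the first vertex from the faces containing it; on a
    single vertex the value is [F [::]]. *)
Fixpoint lbd F l : k :=
  if l is v :: l' then F l' - lbd (pcons F v) l' else 0.

Lemma eq_lbd F G l :
  (forall t, (size t).+1 = size l -> F t = G t) -> lbd F l = lbd G l.
Proof.
elim: l F G => //= v l IH F G FG; rewrite FG //; congr (_ - _).
by apply: IH => t tl; apply: FG; rewrite /= tl.
Qed.

Lemma lbdZ a F l : lbd (fun t => a * F t) l = a * lbd F l.
Proof.
elim: l F => [|v l IH] F /=; first by rewrite mulr0.
by rewrite (IH (pcons F v)) mulrBr.
Qed.

Lemma lbdB F G l : lbd (fun t => F t - G t) l = lbd F l - lbd G l.
Proof.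
elim: l F G => [|v l IH] F G /=; first by rewrite subr0.
by rewrite (IH (pcons F v) (pcons G v)); ring.
Qed.

(** The recursion from the other end, which is what reversal turns the defining one into. *)
Lemma lbd_rcons F l v :
  lbd F (rcons l v) = lbd (prcons F v) l + (-1) ^+ size l * F l.
Proof.
elim: l F => [|w l IH] F /=; first by rewrite subr0 add0r mul1r.
by rewrite IH exprS mulN1r mulNr opprD addrA.
Qed.

Lemma lbd_sum F l :
  lbd F l = \sum_(i < size l) (-1) ^+ i * F (take i l ++ drop i.+1 l).
Proof.
elim: l F => [|v l IH] F; first by rewrite big_ord0.
rewrite big_ord_recl /= mul1r drop0 IH; congr (_ + _).
by rewrite -sumrN; apply: eq_bigr => i _; rewrite exprS mulN1r mulNr.
Qed.

(** The exponent is the number of inversions of the reversal of [size l] vertices; this sign makes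
    [lrev] a cochain map. *)
Definition lrev F l := (-1) ^+ 'C(size l, 2) * F (rev l).

Lemma lrev_cons F v l : lrev F (v :: l) = (-1) ^+ size l * lrev (prcons F v) l.
Proof.
rewrite /lrev /= binS bin1 exprD rev_cons mulrA; congr (_ * _).
by rewrite mulrC.
Qed.

(** Reversal exchanges the faces opposite the first and the last vertex, so [lbd_rcons] on one side
    meets the recursion of [lbd] on the other. *)
Lemma lrev_lbd F l : lrev (lbd F) l = lbd (lrev F) l.
Proof.
elim: l F => [|v l IH] F; first by rewrite /lrev mulr0.
rewrite lrev_cons {1}/lrev /prcons.
have -> t : lbd F (rcons t v) = lbd (prcons F v) t + (-1) ^+ size t * F t.
  exact: lbd_rcons.
rewrite mulrDr size_rev [_ * lbd _ _]IH mulrDr addrC /=; congr (_ + _).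
  by rewrite mulrCA [_ * (_ ^+ size l * F _)]mulrA -expr2 sqrr_sign mul1r.
rewrite -[RHS]mulN1r -!lbdZ; apply: eq_lbd => t <-.
by rewrite /pcons lrev_cons exprS -mulrA.
Qed.

(** The prism operator: for l = v_0, ..., v_n, a signed sum over i of the values of F at v_0, ...,
    v_i, v_n, ..., v_i, where v_i occurs twice. *)
Fixpoint lprism F l : k :=
  if l is v :: l' then lrev (pcons F v) l - lprism (pcons F v) l' else 0.

Lemma lrevB F G l : lrev (fun t => F t - G t) l = lrev F l - lrev G l.
Proof. exact: mulrBr. Qed.

Lemma lprismB F G l :
  lprism (fun t => F t - G t) l = lprism F l - lprism G l.
Proof.
elim: l F G => [|v l IH] F G /=; first by rewrite subr0.
rewrite (IH (pcons F v) (pcons G v)) (lrevB (pcons F v) (pcons G v)).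
by ring.
Qed.

(* The recursion for [lprism] is that of the cone with apex the first vertex,
   which is what makes reversal homotopic to the identity. *)
Lemma lprism_homotopy F l :
  lprism (lbd F) l = lrev F l - F l - lbd (lprism F) l.
Proof.
elim: l F => [|v l IH] F; first by rewrite /lrev /= mul1r !subrr.
rewrite /= (_ : pcons (lbd F) v = fun t => F t - lbd (pcons F v) t) //.
rewrite lrevB lprismB IH (lrev_lbd (pcons F v)) /=.
rewrite (_ : pcons (lprism F) v =
  fun t => pcons (lrev (pcons F v)) v t - lprism (pcons F v) t) //.
rewrite lbdB /pcons.
by ring.
Qed.

Lemma lprism_size F l :
  (forall t, size t = (size l).+1 -> F t = 0) -> lprism F l = 0.
Proof.
elim: l F => //= v l IH F F0; rewrite IH => [|t tl].
  by rewrite subr0 /lrev /pcons F0 ?mulr0 //= size_rev.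
by rewrite /pcons F0 //= tl.
Qed.

(** The front and back faces share the vertex at position p. Only the degree of the first factor is
    recorded; the second one receives all remaining vertices. *)
Definition lcup p F G l := F (take p.+1 l) * G (drop p l).

(** The Leibniz rule. The last face in [lbd F] and the first face in [lbd G] contribute the same
    product with opposite signs and cancel. *)
Lemma lbd_lcup p F G l : (p.+1 < size l)%N ->
  lbd (lcup p F G) l = lbd F (take p.+2 l) * G (drop p.+1 l) +
    (-1) ^+ p * (F (take p.+1 l) * lbd G (drop p l)).
Proof.
elim: p F l => [|p IH] F [//|v l] /=.
  case: l => // w l _ /=; rewrite mul1r.
  rewrite (_ : pcons (lcup 0 F G) v = fun t => F [:: v] * pcons G v t);
    last first.
    by apply/funext => t; rewrite /pcons /lcup /= take0.
  by rewrite lbdZ /lcup /= !take0 ?drop0 /pcons /=; ring.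
rewrite ltnS => pl.
rewrite (_ : pcons (lcup p.+1 F G) v = lcup p (pcons F v) G) //.
by rewrite IH // /lcup exprS /pcons; ring.
Qed.

(** The source of graded commutativity: reversal swaps front and back faces, and the three reversal
    signs differ by p q inversions. *)
Lemma lrev_lcup p q F G l : size l = (p + q).+1 ->
  lrev (lcup p F G) l = (-1) ^+ (p * q) * lcup q (lrev G) (lrev F) l.
Proof.
move=> sl; rewrite /lrev /lcup.
have -> : take p.+1 (rev l) = rev (drop q l).
  by rewrite take_rev sl -addSn addKn.
have -> : drop p (rev l) = rev (take q.+1 l).
  by rewrite drop_rev sl -addnS addKn.
rewrite size_drop size_takel sl ?ltnS ?leq_addl // -addSn addnK.
have -> : 'C((p + q).+1, 2) = ('C(p.+1, 2) + 'C(q.+1, 2) + p * q)%N.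
  elim: p {sl} => [|p IH]; first by rewrite mul0n addn0.
  by rewrite addSn binS bin1 IH [in RHS]binS bin1; lia.
by rewrite !exprD; ring.
Qed.

End ListCochains.

Section MapCochains.
Context {k : fieldType} {T U : Type} (f : T -> U).
Implicit Types (F : seq U -> k) (l : seq T).

Lemma lrev_map F l : lrev F (map f l) = lrev (F \o map f) l.
Proof. by rewrite /lrev size_map -map_rev. Qed.

Lemma lprism_map F l : lprism F (map f l) = lprism (F \o map f) l.
Proof.
by elim: l F => //= v l IH F; rewrite IH -map_cons lrev_map.
Qed.

End MapCochains.

(** * Singular cochains *)

Section Restrictions.
Context {R : realType} {X : topologicalType}.

Lemma smap_comp {a b c} (f : 'I_b.+1 -> 'I_c.+1) (g : 'I_a.+1 -> 'I_b.+1)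
    (t : simplex R a) : smap f (smap g t) = smap (f \o g) t.
Proof.
apply: val_inj; apply/rowP => j; rewrite !mxE.
under eq_bigr do rewrite mxE.
rewrite [RHS](partition_big g (fun i => f i == j)) //=.
apply: eq_bigr => i fi; apply: eq_bigl => h.
by case: eqP => [->|]; rewrite ?fi ?andbF.
Qed.

Lemma smap_id {a} (t : simplex R a) : smap id t = t.
Proof.
apply: val_inj; apply/rowP => j; rewrite mxE.
by rewrite (big_pred1 j) // => i.
Qed.

Lemma restr_comp {a b c} (s : sing R c X) (f : 'I_b.+1 -> 'I_c.+1)
    (g : 'I_a.+1 -> 'I_b.+1) : restr (restr s f) g = restr s (f \o g).
Proof. by apply/continuousEP => t /=; rewrite smap_comp. Qed.

Lemma restr_id {a} (s : sing R a X) : restr s id = s.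
Proof. by apply/continuousEP => t /=; rewrite smap_id. Qed.

End Restrictions.

Section Cochains.
Context {R : realType} {k : fieldType} {X : topologicalType}.
Local Notation cochain n := (cochain R k n X).

(* The value of a cochain on the simplex of [s] with vertices [l], and 0 if
   the number of vertices is wrong. *)
Definition lcoc {n m} (phi : cochain n) (s : sing R m X) (l : seq 'I_m.+1) : k :=
  if size l == n.+1 then phi (restr s (fun i : 'I_n.+1 => nth ord0 l i)) else 0.

Lemma lcoc_restr {n a b} (phi : cochain n) (s : sing R b X)
    (f : 'I_a.+1 -> 'I_b.+1) l :
  lcoc phi (restr s f) l = lcoc phi s (map f l).
Proof.
rewrite /lcoc size_map; case: eqP => // sl; congr phi.
rewrite restr_comp; congr restr; apply/funext => i /=.
by rewrite (nth_map ord0) // sl.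
Qed.

Lemma lcoc_enum {n} (phi : cochain n) s : lcoc phi s (enum 'I_n.+1) = phi s.
Proof.
rewrite /lcoc size_enum_ord eqxx; congr phi; rewrite -[RHS]restr_id.
by congr restr; apply/funext => i; rewrite nth_ord_enum.
Qed.

Lemma lcoc0 {n m} (phi : cochain n) (s : sing R m X) l :
  size l <> n.+1 -> lcoc phi s l = 0.
Proof. by rewrite /lcoc => /eqP/negbTE->. Qed.

Definition coc_of (G : forall m, sing R m X -> seq 'I_m.+1 -> k) n : cochain n :=
  fun s => G n s (enum 'I_n.+1).
Arguments coc_of G n : clear implicits.

(** Under this condition G is determined by its values on full vertex lists, so that [lcoc] recovers
    G from [coc_of G]. *)
Definition natural (G : forall m, sing R m X -> seq 'I_m.+1 -> k) :=
  forall a b (s : sing R b X) (f : 'I_a.+1 -> 'I_b.+1) l,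
    G a (restr s f) l = G b s (map f l).

Lemma lcoc_of G n m (s : sing R m X) l : natural G -> size l = n.+1 ->
  lcoc (coc_of G n) s l = G m s l.
Proof.
move=> nG sl; rewrite /lcoc sl eqxx /coc_of nG; congr (G m s).
apply: (@eq_from_nth _ ord0) => [|i];
  rewrite size_map size_enum_ord ?sl // => ni.
by rewrite (nth_map ord0) ?size_enum_ord // nth_enum_ord.
Qed.

Lemma lcoc_coboundary {n m} (phi : cochain n) (s : sing R m X) l :
  lcoc (coboundary phi) s l = lbd (lcoc phi s) l.
Proof.
have sz i : (i < size l)%N -> (size (take i l ++ drop i.+1 l)).+1 = size l.
  by move=> il; rewrite size_cat size_drop size_takel 1?ltnW //; lia.
rewrite lbd_sum [LHS]/lcoc; case: eqP => sl; last first.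
  (* If l has the wrong length for the coboundary, then all its faces have the wrong length for
     [phi]. *)
  rewrite big1 // => i _; rewrite lcoc0 ?mulr0 // => si.
  by have := sz i (ltn_ord i); rewrite si => /esym.
rewrite -(big_mkord xpredT
  (fun i => (-1) ^+ i * lcoc phi s (take i l ++ drop i.+1 l))) sl big_mkord.
apply: eq_bigr => i _; congr (_ * _).
have il : (i < size l)%N by rewrite sl.
have := sz _ il; rewrite sl => -[si].
rewrite /lcoc si eqxx restr_comp; congr phi; congr restr; apply/funext => j /=.
rewrite nth_cat (size_takel (ltnW il)) /bump; have [ij|ij] := ltnP j i.
  by rewrite nth_take.
by rewrite nth_drop; congr nth; lia.
Qed.

Lemma lcoc_cup {p q m} (phi : cochain p) (psi : cochain q) (s : sing R m X) l :
  lcoc (cup_cochain phi psi) s l = lcup p (lcoc phi s) (lcoc psi s) l.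
Proof.
rewrite /lcup {1}/lcoc; case: eqP => [sl|nsl]; last first.
  (* For l of the wrong length one of the two factors takes its default value 0: the first if l has
     at most p vertices, the second otherwise. *)
  have [pl|lp] := ltnP p (size l); last first.
    by rewrite lcoc0 ?mul0r // size_take ltnNge (leq_trans lp) //= => e; lia.
  by rewrite [X in _ * X]lcoc0 ?mulr0 // size_drop => e; apply: nsl; lia.
rewrite /cup_cochain !restr_comp /lcoc size_takel ?sl ?ltnS ?leq_addr // eqxx.
have -> : size (drop p l) == q.+1 by rewrite size_drop sl; apply/eqP; lia.
congr (phi _ * psi _).
  congr restr; apply/funext => i /=; rewrite inordK ?nth_take //.
  by rewrite (leq_trans (ltn_ord i)) // ltnS leq_addr.
congr restr; apply/funext => i /=; rewrite inordK ?nth_drop //.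
by rewrite ltnS leq_add2l -ltnS.
Qed.

Lemma coboundary_linear {n} a (phi psi : cochain n) :
  coboundary (a *: phi + psi) = a *: coboundary phi + coboundary psi.
Proof.
apply/funext => s; rewrite /coboundary.
rewrite [RHS](_ : _ =
    a * (\sum_(i < n.+2) (-1) ^+ i * phi (restr s (fintype.lift i)))
  + \sum_(i < n.+2) (-1) ^+ i * psi (restr s (fintype.lift i))) //.
rewrite mulr_sumr -big_split; apply: eq_bigr => i _ /=.
rewrite (_ : (a *: phi + psi) _ = a * phi (restr s (fintype.lift i))
  + psi (restr s (fintype.lift i))) //; ring.
Qed.

Lemma coboundary0 {n} : coboundary (0 : cochain n) = 0.
Proof. exact: linear_fun0 coboundary_linear. Qed.

Lemma cocycles_subspace {n} : subspace (@cocycles R k n X).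
Proof.
split=> [|a phi psi dphi dpsi]; first exact: coboundary0.
by rewrite /cocycles /= coboundary_linear dphi dpsi scaler0 addr0.
Qed.

Lemma coboundaries_subspace {n} : subspace (@coboundaries R k n X).
Proof.
case: n => [|n]; split=> //=.
- by move=> a x y -> ->; rewrite scaler0 addr0.
- by exists 0 => //; exact: coboundary0.
- move=> a _ _ [x _ <-] [y _ <-]; exists (a *: x + y) => //.
  exact: coboundary_linear.
Qed.

Lemma cocycle_lbd {n m} (phi : cochain n) (s : sing R m X) l :
  cocycles phi -> lbd (lcoc phi s) l = 0.
Proof.
by move=> dphi; rewrite -lcoc_coboundary dphi /lcoc; case: ifP.
Qed.

(** Transfers primitives from lists to singular cochains. In degree 0, where 0 is the only
    coboundary, the vanishing of G on the empty list removes the augmentation term of [lbd]. *)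
Lemma coboundaries_natural n (phi : cochain n)
    (G : forall m, sing R m X -> seq 'I_m.+1 -> k) :
  natural G -> (forall m (s : sing R m X), G m s [::] = 0) ->
  (forall s, phi s = lbd (G n s) (enum 'I_n.+1)) -> coboundaries phi.
Proof.
move=> nG G0 phiG; case: n => [|n] in phi phiG *.
  apply/funext => s; rewrite phiG; case: (enum _) (size_enum_ord 1) => //= x.
  by case=> //=; rewrite G0 subrr.
exists (coc_of G n) => //; apply/funext => s.
rewrite phiG -lcoc_enum lcoc_coboundary; apply: eq_lbd => t.
by rewrite size_enum_ord => -[st]; rewrite lcoc_of.
Qed.

Lemma cup_cocycle {p q} (phi : cochain p) (psi : cochain q) :
  cocycles phi -> cocycles psi -> cocycles (cup_cochain phi psi).
Proof.
move=> dphi dpsi; apply/funext => s; rewrite -[LHS]lcoc_enum lcoc_coboundary.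
rewrite (_ : lcoc _ s = lcup p (lcoc phi s) (lcoc psi s)); last first.
  by apply/funext => l; rewrite lcoc_cup.
rewrite lbd_lcup ?size_enum_ord ?ltnS ?leq_addr //.
by rewrite !cocycle_lbd // !(mulr0, mul0r) addr0.
Qed.

Lemma cup_coboundary_r {p q} (phi : cochain p) (psi : cochain q) :
  cocycles phi -> coboundaries psi -> coboundaries (cup_cochain phi psi).
Proof.
move=> dphi; case: q psi => [|q] psi /=.
  move=> ->; rewrite (_ : cup_cochain _ _ = 0).
    exact: coboundaries_subspace.1.
  by apply/funext => s; rewrite /cup_cochain mulr0.
case=> theta _ <-.
(* The primitive is the product of [phi] and [theta], with the sign that the Leibniz rule produces.
   Writing it on lists avoids a cast between p + q.+1 and (p + q).+1. *)
apply: (@coboundaries_natural _ _ (fun m s l =>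
   (-1) ^+ p * lcup p (lcoc phi s) (lcoc theta s) l)).
- by move=> a b s f l; rewrite /lcup !lcoc_restr map_take map_drop.
- by move=> m s; rewrite /lcup lcoc0 // mul0r mulr0.
move=> s; rewrite -[LHS]lcoc_enum lcoc_cup lbdZ lbd_lcup; last first.
  by rewrite size_enum_ord addnS !ltnS leq_addr.
rewrite cocycle_lbd // mul0r add0r mulrA -expr2 sqrr_sign mul1r.
by rewrite /lcup lcoc_coboundary.
Qed.

Lemma cup_coboundary_l {p q} (phi : cochain p) (psi : cochain q) :
  coboundaries phi -> cocycles psi -> coboundaries (cup_cochain phi psi).
Proof.
move=> + dpsi; case: p phi => [|p] phi.
  move=> phi0; rewrite (phi0 : phi = 0) (_ : cup_cochain _ _ = 0).
    exact: coboundaries_subspace.1.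
  by apply/funext => s; rewrite /cup_cochain mul0r.
case=> theta _ <-.
apply: (@coboundaries_natural _ _ (fun m s l =>
   lcup p (lcoc theta s) (lcoc psi s) l)).
- by move=> a b s f l; rewrite /lcup !lcoc_restr map_take map_drop.
- by move=> m s; rewrite /lcup lcoc0 // mul0r.
move=> s; rewrite -[LHS]lcoc_enum lcoc_cup lbd_lcup; last first.
  by rewrite size_enum_ord !ltnS leq_addr.
rewrite [lbd (lcoc psi s) _]cocycle_lbd // !mulr0 addr0.
by rewrite /lcup lcoc_coboundary.
Qed.

Definition rev_cochain {n} (phi : cochain n) : cochain n :=
  coc_of (fun m s l => lrev (lcoc phi s) l) n.

Lemma lcoc_rev {n m} (phi : cochain n) (s : sing R m X) l :
  lcoc (rev_cochain phi) s l = lrev (lcoc phi s) l.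
Proof.
case: (eqVneq (size l) n.+1) => [sl|/eqP nsl]; last first.
  by rewrite !lcoc0 // /lrev lcoc0 ?mulr0 // size_rev.
rewrite lcoc_of // => a b s' f t; rewrite lrev_map; congr lrev.
by apply/funext => u; rewrite lcoc_restr.
Qed.

Lemma rev_cocycle {n} (phi : cochain n) :
  cocycles phi -> cocycles (rev_cochain phi).
Proof.
move=> dphi; apply/funext => s; rewrite -[LHS]lcoc_enum lcoc_coboundary.
rewrite (_ : lcoc _ s = lrev (lcoc phi s)).
  by rewrite -lrev_lbd /lrev cocycle_lbd // mulr0.
by apply/funext => l; rewrite lcoc_rev.
Qed.

(** For a cocycle the term [lprism (lbd _)] of the prism homotopy vanishes, so [lprism] gives the
    primitive. *)
Lemma rev_homologous {n} (phi : cochain n) :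
  cocycles phi -> coboundaries (rev_cochain phi - phi).
Proof.
move=> dphi; apply: (@coboundaries_natural _ _ (fun m s l =>
  lprism (lcoc phi s) l)) => //.
  move=> a b s f l; rewrite lprism_map; congr lprism.
  by apply/funext => t; rewrite lcoc_restr.
move=> s; have := lprism_homotopy (lcoc phi s) (enum 'I_n.+1).
rewrite (_ : lbd (lcoc phi s) = fun=> 0); last first.
  by apply/funext => l; rewrite cocycle_lbd.
rewrite (lprism_size (F := fun=> 0)) // lcoc_enum.
by move/esym/eqP; rewrite subr_eq0 => /eqP.
Qed.

End Cochains.

(** * The cohomology ring *)

Section CohomologyRing.
Context {R : realType} {k : fieldType} {X : topologicalType}.
Local Notation cochain n := (cochain R k n X).
Local Notation cohom n := (cohom R k n X).

Lemma cohclass_linear {n} a (phi psi : cochain n) : cocycles phi -> cocycles psi ->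
  cohclass (a *: phi + psi) = a *: cohclass phi + cohclass psi.
Proof. exact: (hclass_linear _ cocycles_subspace). Qed.

Lemma cohclassZ {n} a (phi : cochain n) : cocycles phi ->
  cohclass (a *: phi) = a *: cohclass phi.
Proof.
move=> dphi; have d0 := @cocycles_subspace R k X n.
have := cohclass_linear a dphi d0.1; rewrite addr0 => ->.
have := cohclass_linear (-1) d0.1 d0.1; rewrite !scaleN1r !addNr => ->.
by rewrite addr0.
Qed.

Lemma cohrep_cocycle {n} (v : cohom n) : cocycles (cohrep v).
Proof. exact: (hrep_cycle cocycles_subspace). Qed.

Lemma cohrepK {n} (v : cohom n) : cohclass (cohrep v) = v.
Proof. exact: hrepK. Qed.

Lemma cohclass_eqP {n} (phi psi : cochain n) : cocycles phi -> cocycles psi ->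
  cohclass phi = cohclass psi <-> coboundaries (phi - psi).
Proof. exact: hclass_eqP coboundaries_subspace _ _. Qed.

Lemma cohrep_cohclass {n} (phi : cochain n) :
  cocycles phi -> coboundaries (cohrep (cohclass phi) - phi).
Proof.
by move=> dphi; apply/cohclass_eqP; rewrite ?cohrepK //; apply: cohrep_cocycle.
Qed.

Lemma cup_cohclass {p q} (phi : cochain p) (psi : cochain q) :
  cocycles phi -> cocycles psi ->
  cup (cohclass phi) (cohclass psi) = cohclass (cup_cochain phi psi).
Proof.
move=> dphi dpsi; set phi' := cohrep (cohclass phi).
set psi' := cohrep (cohclass psi).
have dphi' : cocycles phi' by exact: cohrep_cocycle.
have dpsi' : cocycles psi' by exact: cohrep_cocycle.
apply/cohclass_eqP; [exact: cup_cocycle..|].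
(* The representatives are changed one at a time; the scalar 1 only serves to match the form of
   [subspace]. *)
rewrite (_ : _ - _ = 1 *: cup_cochain (phi' - phi) psi' +
  cup_cochain phi (psi' - psi)); last first.
  rewrite scale1r; apply/funext => s.
  have fB n (f g : cochain n) t : (f - g) t = f t - g t by [].
  have fD n (f g : cochain n) t : (f + g) t = f t + g t by [].
  by rewrite fB fD /cup_cochain !fB mulrBl mulrBr addrA subrK.
apply: coboundaries_subspace.2.
  by apply: cup_coboundary_l => //; apply: cohrep_cohclass.
by apply: cup_coboundary_r => //; apply: cohrep_cohclass.
Qed.

Lemma cup_linearl {p q} (w : cohom q) : linear (fun v : cohom p => cup v w).
Proof.
move=> a v v'; rewrite -(cohrepK v) -(cohrepK v') -(cohrepK w).
have cv := cohrep_cocycle v; have cv' := cohrep_cocycle v'.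
have cw := cohrep_cocycle w.
rewrite -cohclass_linear // !cup_cohclass //; last exact: cocycles_subspace.2.
rewrite -cohclass_linear //; [|exact: cup_cocycle..]; congr cohclass.
apply/funext => s; rewrite [LHS]mulrDl; congr (_ + _).
by rewrite -[RHS]/(a * _) /cup_cochain mulrA.
Qed.

Lemma cup_linearr {p q} (v : cohom p) : linear (fun w : cohom q => cup v w).
Proof.
move=> a w w'; rewrite -(cohrepK v) -(cohrepK w) -(cohrepK w').
have cv := cohrep_cocycle v; have cw' := cohrep_cocycle w'.
have cw := cohrep_cocycle w.
rewrite -cohclass_linear // !cup_cohclass //; last exact: cocycles_subspace.2.
rewrite -cohclass_linear //; [|exact: cup_cocycle..]; congr cohclass.
apply/funext => s; rewrite [LHS]mulrDr; congr (_ + _).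
by rewrite -[RHS]/(a * _) /cup_cochain [LHS]mulrCA.
Qed.

Lemma lcocZ {n m} a (phi : cochain n) (s : sing R m X) l :
  lcoc (a *: phi) s l = a * lcoc phi s l.
Proof. by rewrite /lcoc; case: ifP; rewrite ?mulr0. Qed.

Lemma cup0l {p q} (w : cohom q) : cup (0 : cohom p) w = 0.
Proof. exact: (linear_fun0 (cup_linearl w)). Qed.

Lemma cup0r {p q} (v : cohom p) : cup v (0 : cohom q) = 0.
Proof. exact: (linear_fun0 (cup_linearr v)). Qed.

Lemma one_cocycle : cocycles ((fun=> 1) : cochain 0).
Proof.
apply/funext => s; rewrite /coboundary !big_ord_recl big_ord0 /= expr1 expr0.
by rewrite !mulr1 addr0 subrr.
Qed.

(** Degrees such as p + (q + r) and (p + q) + r are equal without being convertible. The classes are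
    therefore compared in the sigma type, and their cochains on lists, where no transport occurs. *)
Lemma cohclass_cast {m n} (phi : cochain m) (psi : cochain n) : m = n ->
  (forall a (s : sing R a X) l, lcoc phi s l = lcoc psi s l) ->
  existT (fun i => cohom i) m (cohclass phi) = existT _ n (cohclass psi).
Proof.
move=> mn; case: n / mn psi => psi phipsi; rewrite (_ : phi = psi) //.
by apply/funext => s; rewrite -lcoc_enum phipsi lcoc_enum.
Qed.

End CohomologyRing.

(** * Functoriality of the cohomology ring *)

Section Pullback.
Context {R : realType} {k : fieldType} {X Y : topologicalType}.
Variable f : continuousType X Y.

Definition pullback_cochain {n} (phi : cochain R k n Y) : cochain R k n X :=
  fun s => phi [the continuousType (simplex R n) Y of f \o s].

Lemma lcoc_pullback {n m} (phi : cochain R k n Y) (s : sing R m X) l :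
  lcoc (pullback_cochain phi) s l =
  lcoc phi [the continuousType (simplex R m) Y of f \o s] l.
Proof.
rewrite /lcoc; case: ifP => // _; congr phi.
by apply/continuousEP => t.
Qed.

Lemma pullback_coboundary {n} (phi : cochain R k n Y) :
  coboundary (pullback_cochain phi) = pullback_cochain (coboundary phi).
Proof.
apply/funext => s; rewrite -[LHS]lcoc_enum -[RHS]lcoc_enum lcoc_pullback.
rewrite !lcoc_coboundary; congr lbd.
by apply/funext => l; rewrite lcoc_pullback.
Qed.

Lemma pullback_cocycle {n} (phi : cochain R k n Y) :
  cocycles phi -> cocycles (pullback_cochain phi).
Proof. by move=> dphi; rewrite /cocycles /= pullback_coboundary dphi. Qed.

Lemma pullback_cohclass {n} (phi : cochain R k n Y) :
  cocycles phi -> pullback f (cohclass phi) = cohclass (pullback_cochain phi).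
Proof.
move=> dphi; set phi' := cohrep (cohclass phi).
have dphi' : cocycles phi' by exact: cohrep_cocycle.
apply/cohclass_eqP; [exact: pullback_cocycle..|].
have := cohrep_cohclass dphi; rewrite -/phi'.
rewrite (_ : _ - pullback_cochain phi = pullback_cochain (phi' - phi)) //.
case: (n) (phi' - phi) => [|m] psi; first by move=> /= ->.
case=> theta _ <-; exists (pullback_cochain theta) => //.
exact: pullback_coboundary.
Qed.

Lemma pullback_linear {n} : linear (fun v : cohom R k n Y => pullback f v).
Proof.
move=> a v w; rewrite -(cohrepK v) -(cohrepK w).
have cv := cohrep_cocycle v; have cw := cohrep_cocycle w.
rewrite -cohclass_linear // !pullback_cohclass //; last exact: cocycles_subspace.2.
by rewrite -cohclass_linear //; exact: pullback_cocycle.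
Qed.

Lemma pullback0 {n} : pullback f (0 : cohom R k n Y) = 0.
Proof. exact: (linear_fun0 pullback_linear). Qed.

Lemma pullback_cup {p q} (v : cohom R k p Y) (w : cohom R k q Y) :
  pullback f (cup v w) = cup (pullback f v) (pullback f w).
Proof.
rewrite -(cohrepK v) -(cohrepK w).
have cv := cohrep_cocycle v; have cw := cohrep_cocycle w.
rewrite !(cup_cohclass, pullback_cohclass) //; last exact: cup_cocycle.
  congr cohclass; apply/funext => s.
  rewrite -[LHS]lcoc_enum -[RHS]lcoc_enum lcoc_pullback !lcoc_cup /lcup.
  by rewrite !lcoc_pullback.
all: exact: pullback_cocycle.
Qed.

Lemma pullback_coh1 : pullback f (coh1 R k (X := Y)) = coh1 R k (X := X).
Proof. by rewrite pullback_cohclass //; exact: one_cocycle. Qed.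

End Pullback.

(** * Associativity and graded commutativity of the cup product *)

Section GradedRing.
Context {R : realType} {k : fieldType} {X : topologicalType}.
Local Notation cohom n := (cohom R k n X).

Definition gcohom : Type := {i : nat & cohom i}.
Definition gcup (x y : gcohom) : gcohom :=
  Tagged (fun i => cohom i) (cup (tagged x) (tagged y)).
Definition gone : gcohom := Tagged (fun i => cohom i) (coh1 R k (X := X)).
Implicit Types x y z : gcohom.

Lemma gcupA x y z : gcup x (gcup y z) = gcup (gcup x y) z.
Proof.
case: x y z => [p u] [q v] [r w]; rewrite /gcup /=.
rewrite -(cohrepK u) -(cohrepK v) -(cohrepK w).
have cu := cohrep_cocycle u; have cv := cohrep_cocycle v.
have cw := cohrep_cocycle w.
have cuv := cup_cocycle cu cv; have cvw := cup_cocycle cv cw.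
rewrite !cup_cohclass //; apply: cohclass_cast => [|a s l]; first exact: addnA.
rewrite !lcoc_cup /lcup !lcoc_cup /lcup mulrA take_takel ?ltnS ?leq_addr //.
by rewrite drop_drop take_drop addSn addnC.
Qed.

Lemma gcupr1 x : gcup x gone = x.
Proof.
case: x => [p u]; rewrite /gcup /= -(cohrepK u).
have cu := cohrep_cocycle u.
rewrite cup_cohclass //; last exact: one_cocycle.
apply: cohclass_cast => [|a s l]; first exact: addn0.
rewrite lcoc_cup /lcup [X in _ * X]/lcoc size_drop.
case: eqP => [sl|nsl]; last by rewrite mulr0 lcoc0 // => sl; lia.
by rewrite mulr1 take_oversize //; lia.
Qed.

Lemma cohclass_rev {n} (phi : cochain R k n X) :
  cocycles phi -> cohclass (rev_cochain phi) = cohclass phi.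
Proof.
move=> dphi; apply/cohclass_eqP => //; first exact: rev_cocycle.
exact: rev_homologous.
Qed.

(** By [cohclass_rev] the two classes and their product may all be represented by reversed cochains,
    and for these [lrev_lcup] gives the identity on the nose. *)
Lemma gcupC {p q} (v : cohom p) (w : cohom q) :
  gcup (Tagged (fun i => cohom i) v) (Tagged (fun i => cohom i) w) =
  Tagged (fun i => cohom i) ((-1) ^+ (p * q) *: cup w v).
Proof.
rewrite /gcup /= -(cohrepK v) -(cohrepK w).
have cv := cohrep_cocycle v; have cw := cohrep_cocycle w.
have rv := rev_cocycle cv; have rw := rev_cocycle cw.
rewrite cup_cohclass // -(cohclass_rev (cup_cocycle cv cw)).
rewrite -(cohclass_rev cv) -(cohclass_rev cw) cup_cohclass // -cohclassZ;
  last first.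
  exact: cup_cocycle.
apply: cohclass_cast => [|a s l]; first exact: addnC.
rewrite lcoc_rev lcocZ lcoc_cup.
case: (eqVneq (size l) (p + q).+1) => [sl|/eqP nsl]; last first.
  rewrite /lrev lcoc0 ?size_rev // mulr0 -lcoc_cup lcoc0 ?mulr0 //.
  by rewrite addnC.
rewrite (_ : lcoc _ s = lcup p (lcoc (cohrep v) s) (lcoc (cohrep w) s)).
  rewrite (lrev_lcup _ _ sl); congr (_ * _).
  by rewrite /lcup !lcoc_rev.
by apply/funext => t; rewrite lcoc_cup.
Qed.

(* [x y z y = +- x y y z] *)
Lemma gcup_sq0 x y z : tagged (gcup y y) = 0 ->
  tagged (gcup (gcup x y) (gcup z y)) = 0.
Proof.
move=> yy0; rewrite -gcupA.
suff zyy0 : tagged (gcup y (gcup z y)) = 0.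
  exact: etrans (congr1 (cup (tagged x)) zyy0) (cup0r _).
rewrite gcupA; case: y z yy0 => [q v] [r w] vv0; rewrite gcupC.
have vvw0 : tagged (gcup (existT _ q v)
    (gcup (existT _ q v) (existT _ r w))) = 0.
  by rewrite gcupA /= (vv0 : cup v v = 0) cup0l.
rewrite /= (vvw0 : cup v (cup v w) = 0).
exact: scaler0.
Qed.

End GradedRing.

(** * Reduced cohomology and the Thom space *)

Section Reduced.
Context {R : realType} {k : fieldType} {X : ptopologicalType}.
Local Notation cohom n := (cohom R k n X).

Lemma reduced_subspace {n} : subspace (@reduced R k X n).
Proof.
split=> [|a v w rv rw]; first exact: pullback0.
by rewrite /reduced /= pullback_linear rv rw scaler0 addr0.
Qed.

Lemma reduced_cupl {p q} (v : cohom p) (w : cohom q) :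
  reduced v -> reduced (cup v w).
Proof. by rewrite /reduced /= pullback_cup => ->; rewrite cup0l. Qed.

Lemma reduced_cupr {p q} (v : cohom p) (w : cohom q) :
  reduced w -> reduced (cup v w).
Proof. by rewrite /reduced /= pullback_cup => ->; rewrite cup0r. Qed.

Lemma redcohomP {n} (v : redcohom R k X n) : reduced (val v).
Proof. exact: subspace_span reduced_subspace _ (valP v). Qed.

End Reduced.

Section ThomSpace.
Context {R : realType} {k : fieldType} {n : nat} {S B : topologicalType}.
Variable p : continuousType S B.
Local Notation M := (thom_space R p).
Variable u : cohom R k n M.
Hypotheses (hu : orientation_class u) (uu0 : cup u u = 0).

(* Uniqueness of the value of the Thom map at 0. *)
Lemma thom_diag_eq0 N (w : cohom R k N (smash R p)) : (n <= N)%N ->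
  reduced w -> pullback (collapse_pi (@smash_base R S B p)) w = 0 ->
  pullback (@thom_diag R S B p) w = 0.
Proof.
move=> /subnK; move: (N - n)%N => i iN; case: N / iN w => w rw w0.
have [_ /(_ i 0)[v [_ uniq_v]] _ _] := hu.
(* Both 0 and the pullback of [w] are values of the Thom map at 0: the external products 0 and [w]
   both restrict to 0 on B * M. *)
rewrite -(uniq_v (pullback (@thom_diag R S B p) w)).
  apply: uniq_v; exists 0; last by rewrite pullback0.
  by split; [exact: reduced_subspace.1 | rewrite !pullback0 cup0l].
by exists w => //; split => //; rewrite w0 pullback0 cup0l.
Qed.

Lemma thom_cup_eq0 i j (v : cohom R k i M) (w : cohom R k j M) :
  reduced v -> reduced w -> cup v w = 0.
Proof.
have [_ _ thom_onto low] := hu.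
(* Below degree n the reduced cohomology vanishes. The other degrees are rewritten as a + n and b +
   n, the form of the target of the Thom map. *)
have [ilt|ni] := ltnP i n; first by move=> /(low _ _ ilt)->; rewrite cup0l.
have [jlt rv|nj] := ltnP j n; first by move=> /(low _ _ jlt)->; rewrite cup0r.
have := subnK ni; have := subnK nj; move: (i - n)%N (j - n)%N => a b bj ai.
case: i / ai v {ni} => v; case: j / bj w {nj} => w.
move=> /thom_onto[x [[v' [rv' v'x] ->] _]] /thom_onto[y [[w' [rw' w'y] ->] _]].
rewrite -pullback_cup; apply: thom_diag_eq0.
- by rewrite addnA leq_addl.
- exact: reduced_cupl.
rewrite pullback_cup v'x w'y.
(* On B * M the product reads x u y u; the pulled back [u] is the repeated factor in [gcup_sq0]. *)
pose T := Tagged (fun i => cohom R k i (B * M)%type).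
apply: (@gcup_sq0 _ _ _ (T _ _) (T _ _) (T _ _)).
by rewrite /= -pullback_cup uu0 pullback0.
Qed.

End ThomSpace.

(** * The augmentation *)

Section Point.
Context {R : realType} {k : fieldType} {X : topologicalType}.
Hypothesis X1 : forall x y : X, x = y.

Lemma sing_point {n} (s t : sing R n X) : s = t.
Proof. by apply/continuousEP => x; exact: X1. Qed.

(** All n.+2 faces coincide, and the alternating sum of n.+2 signs is 1 for odd n and 0 for even
    n. *)
Lemma coboundary_point {n} (phi : cochain R k n X) t s :
  coboundary phi t = (odd n)%:R * phi s.
Proof.
rewrite /coboundary; under eq_bigr do rewrite (sing_point (restr _ _) s).
rewrite -mulr_suml; congr (_ * _); rewrite -(negbK (odd n)) -/(odd n.+2).
elim: n.+2 => [|m IH]; first by rewrite big_ord0.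
rewrite big_ord_recr /= IH /= -signr_odd.
by case: (odd m); rewrite ?addr0 ?add0r // expr1 addrN.
Qed.

(** For odd n the coboundary into degree n.+1 hits everything; for even n the one out of degree n.+1
    is injective, so a cocycle is 0. *)
Lemma cohom_point {n} (v : cohom R k n.+1 X) : v = 0.
Proof.
rewrite -(cohrepK v); set phi := cohrep v.
have dphi : cocycles phi by exact: cohrep_cocycle.
apply/(hclass_eq0P cocycles_subspace coboundaries_subspace dphi).
have [nodd|neven] := boolP (odd n).
  (* Collapsing to a vertex merely supplies a simplex of the right dimension; all simplices of that
     dimension are equal. *)
  exists (fun t => phi (restr t (fun=> ord0))) => //.
  apply/funext => s; rewrite (coboundary_point _ _ (restr s (fun=> ord0))) nodd.
  by rewrite mul1r; congr phi; exact: sing_point.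
rewrite (_ : phi = 0); first exact: coboundaries_subspace.1.
apply/funext => s; have := congr1 (@^~ (restr s (fun=> ord0))) dphi.
by rewrite (coboundary_point _ _ s) /= neven mul1r.
Qed.

End Point.

Section Augmentation.
Context {R : realType} {k : fieldType} {X : ptopologicalType}.
Local Notation cohom n := (cohom R k n X).

Let P := set_type [set point : X].

Lemma base_point_eq (x y : P) : x = y.
Proof.
case: x y => [x xP] [y yP]; apply: val_inj => /=.
by rewrite (set_mem xP) (set_mem yP).
Qed.

Let base_point : P :=
  exist _ (point : X) (mem_set (erefl : [set point] (point : X))).

Let base_simplex : sing R 0 P :=
  mkcts (@cst_continuous (simplex R 0) P base_point).

(** The restriction to the base point, evaluated at its 0-simplex. The default of [lcoc] makes this
    0 in positive degrees and allows a single definition for all n. *)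
Definition aug {n} (v : cohom n) : k :=
  lcoc (cohrep (pullback (@incl_point X) v)) base_simplex [:: ord0].

Lemma aug_neq0 {n} (v : cohom n) : (0 < n)%N -> aug v = 0.
Proof. by case: n v => // n v _; rewrite /aug lcoc0. Qed.

(** In degree 0 the only coboundary is 0, so the chosen representative is the only one. *)
Lemma cohrep_linear0 {Y : topologicalType} :
  linear (@cohrep R k 0 Y).
Proof.
move=> a v w; pose phi := a *: cohrep v + cohrep w.
have cphi : cocycles phi.
  by apply: cocycles_subspace.2; exact: cohrep_cocycle.
have -> : a *: v + w = cohclass phi.
  by rewrite cohclass_linear ?cohrepK //; exact: cohrep_cocycle.
by apply/eqP; rewrite -subr_eq0; apply/eqP; exact (cohrep_cohclass cphi).
Qed.

Lemma aug_linear {n} : linear (@aug n : cohom n -> k^o).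
Proof.
case: n => [|n] a v w; last by rewrite !aug_neq0 // scaler0 addr0.
by rewrite /aug pullback_linear cohrep_linear0.
Qed.

Lemma aug_reduced {n} (v : cohom n) : reduced v -> aug v = 0.
Proof.
case: n v => [|n] v; last by rewrite aug_neq0.
by move=> rv; rewrite /aug (rv : pullback _ v = 0) (linear_fun0 cohrep_linear0).
Qed.

Lemma aug1 : aug (coh1 R k (X := X)) = 1.
Proof.
rewrite /aug pullback_coh1 /coh1.
have /eqP := cohrep_cohclass (@one_cocycle R k P : cocycles _).
by rewrite subr_eq0 => /eqP ->.
Qed.

Lemma reduced_gt0 {n} (v : cohom n) : (0 < n)%N -> reduced v.
Proof. by case: n v => // n v _; exact: (cohom_point base_point_eq). Qed.

(** A degree 0 class of the base point is a function on its single 0-simplex, hence a multiple of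
    1. *)
Lemma reduced_aug (v : cohom 0) : reduced (v - aug v *: coh1 R k (X := X)).
Proof.
rewrite /reduced /= addrC -scaleNr pullback_linear pullback_coh1 scaleNr.
apply/eqP; rewrite addrC subr_eq0 -[X in X == _]cohrepK -cohclassZ; last first.
  exact: one_cocycle.
apply/eqP; congr cohclass; apply/funext => s.
have enum1 : [:: ord0] = enum 'I_1 by rewrite enum_ordSl enum_ord0.
rewrite -[RHS]/(aug v * 1) mulr1 /aug enum1 lcoc_enum.
by rewrite (sing_point base_point_eq s base_simplex).
Qed.

End Augmentation.

(** * The bar complex *)

Section BarComplex.
Context {R : realType} {k : fieldType} {X : ptopologicalType}.
Local Notation cohom n := (cohom R k n X).
Local Notation redcohom n := (redcohom R k X n).
Local Notation helt := (helt R k X).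
Local Notation rhelt := (rhelt R k X).
Local Notation word := (word R k X).
Local Notation bar_gen := (bar_gen R k X).
Local Notation bar := (bar R k X).
Local Notation bar_cpx := (bar_cpx R k X).
Implicit Types (w : word) (a : helt).

Let T n (v : cohom n) : helt := Tagged (fun i => Defs.cohom R k i X) v.

Lemma bar_word_linear n w w' (c : k) (x y : redcohom n) :
  let t z := bar_word (w ++ Tagged (fun i => Defs.redcohom R k X i) z :: w') in
  t (c *: x + y) = c *: t x + t y.
Proof.
move=> t; apply/eqP; rewrite -subr_eq0 opprD addrA; apply/eqP.
rewrite -linearZ -!linearB.
by apply/quotpi_eq0/mem_span; exists w, w', n, c, x, y.
Qed.

Section Lift.
Context {W : lmodType k} (f : word -> W).
Hypothesis flin : forall n w w' (c : k) (x y : redcohom n),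
  let t z := f (w ++ Tagged (fun i => Defs.redcohom R k X i) z :: w') in
  t (c *: x + y) = c *: t x + t y.

Let f_relators r : word_relators r -> fglift f r = 0.
Proof.
move=> [w [w' [i [c [x [y ->]]]]]].
by rewrite !linearB linearZ /= !fglift_fgen flin addrAC addrK subrr.
Qed.

Lemma bar_lift_word w : bar_lift f (bar_word w) = f w.
Proof. by rewrite /bar_lift (quotrep_lift f_relators) /= fglift_fgen. Qed.

Lemma bar_lift_linear : linear (bar_lift f).
Proof. exact: quotrep_lift_linear f_relators. Qed.

End Lift.

Lemma bar_ind (P : bar -> Prop) :
  P 0 -> (forall c w z, P z -> P (c *: bar_word w + z)) -> forall z, P z.
Proof.
move=> P0 PS z; rewrite -(quotrepK z).
elim/(@freeg_ind k word): (quotrep z) => [|c w D IH]; first by rewrite linear0.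
by rewrite linearP; exact: PS.
Qed.

Definition cpx_word a w : bar_cpx := quotpi _ (fgen (a, w)).

Lemma cpx_word_linearl w n (c : k) (x y : cohom n) :
  cpx_word (T (c *: x + y)) w = c *: cpx_word (T x) w + cpx_word (T y) w.
Proof.
apply/eqP; rewrite -subr_eq0 opprD addrA; apply/eqP.
rewrite -linearZ -!linearB.
by apply/quotpi_eq0/mem_span; left; left; exists n, c, x, y, w.
Qed.

Lemma cpx_word_linearr a n w w' (c : k) (x y : redcohom n) :
  let t z := cpx_word a (w ++ Tagged (fun i => Defs.redcohom R k X i) z :: w') in
  t (c *: x + y) = c *: t x + t y.
Proof.
move=> t; apply/eqP; rewrite -subr_eq0 opprD addrA; apply/eqP.
rewrite -linearZ -!linearB.
by apply/quotpi_eq0/mem_span; left; right; exists a, w, w', n, c, x, y.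
Qed.

(** Writing v = v 1 exhibits the generator as one of the [augmentation_relators]. *)
Lemma cpx_word_reduced n (v : cohom n) w : reduced v -> cpx_word (T v) w = 0.
Proof.
move=> rv; apply/quotpi_eq0/mem_span; right.
pose b : rhelt := Tagged (fun i => Defs.redcohom R k X i) (SubSpan (mem_span rv)).
exists b, (helt_one R k X), w.
by rewrite [helt_mul _ _](gcupr1 (helt_of b)).
Qed.

Lemma cpx_word_aug n (v : cohom n) w :
  cpx_word (T v) w = aug v *: cpx_word (helt_one R k X) w.
Proof.
case: n v => [|n] v; last first.
  by rewrite aug_neq0 // scale0r cpx_word_reduced //; exact: reduced_gt0.
have {1}-> : v = aug v *: coh1 R k + (v - aug v *: coh1 R k).
  by rewrite addrC subrK.
by rewrite cpx_word_linearl (cpx_word_reduced _ (reduced_aug v)) addr0.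
Qed.

Lemma bar_to_cpx_word w : bar_to_cpx (bar_word w) = cpx_word (helt_one R k X) w.
Proof. exact: (bar_lift_word (cpx_word_linearr _)). Qed.

Lemma bar_to_cpx_linear : linear (@bar_to_cpx R k X).
Proof. exact: (bar_lift_linear (cpx_word_linearr _)). Qed.

HB.instance Definition _ :=
  GRing.isLinear.Build k bar bar_cpx _ (@bar_to_cpx R k X) bar_to_cpx_linear.

Let aug_word (g : bar_gen) : bar := aug (tagged g.1) *: bar_word g.2.

Let aug_relators r :
  (@bar_res_relators R k X `|` @augmentation_relators R k X) r ->
  fglift aug_word r = 0.
Proof.
case=> [[]|].
- move=> [n [c [x [y [w ->]]]]].
  rewrite !linearB linearZ /= !fglift_fgen /aug_word /=.
  by rewrite aug_linear scalerDl -scalerA addrAC addrK subrr.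
- move=> [a [w [w' [n [c [x [y ->]]]]]]].
  rewrite !linearB linearZ /= !fglift_fgen /aug_word /=.
  rewrite bar_word_linear scalerDr scalerA mulrC -scalerA.
  by rewrite addrAC addrK subrr.
- move=> [b [a [w ->]]]; rewrite fglift_fgen /aug_word /=.
  by rewrite aug_reduced ?scale0r //; apply/reduced_cupl/redcohomP.
Qed.

(** The inverse of [bar_to_cpx], induced by the augmentation A -> k on the coefficient of a word. *)
Definition cpx_aug (c : bar_cpx) : bar := fglift aug_word (quotrep c).

Lemma cpx_aug_linear : linear cpx_aug.
Proof. exact: quotrep_lift_linear aug_relators. Qed.

Lemma cpx_aug_word a w : cpx_aug (cpx_word a w) = aug (tagged a) *: bar_word w.
Proof. by rewrite /cpx_aug (quotrep_lift aug_relators) /= fglift_fgen. Qed.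

Lemma bar_to_cpxK : cancel (@bar_to_cpx R k X) cpx_aug.
Proof.
apply: bar_ind => [|c w z IH].
  by rewrite linear0 (linear_fun0 cpx_aug_linear).
by rewrite linearP /= cpx_aug_linear IH bar_to_cpx_word cpx_aug_word aug1 scale1r.
Qed.

Lemma cpx_augK : cancel cpx_aug (@bar_to_cpx R k X).
Proof.
move=> c; rewrite -(quotrepK c).
elim/(@freeg_ind k bar_gen): (quotrep c) => [|b [[n v] w] D IH].
  by rewrite linear0 (linear_fun0 cpx_aug_linear) linear0.
rewrite linearP cpx_aug_linear linearP /=; congr (_ *: _ + _); last exact: IH.
rewrite -[quotpi _ _]/(cpx_word (T v) w) cpx_aug_word linearZ /=.
by rewrite bar_to_cpx_word -cpx_word_aug.
Qed.

(** [cpx_to_bar] picks some preimage under [bar_to_cpx]; bijectivity leaves only one. *)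
Lemma cpx_to_barE : @cpx_to_bar R k X =1 cpx_aug.
Proof.
move=> c; rewrite /cpx_to_bar; case: xgetP => [z _ <-|/(_ (cpx_aug c))].
  by rewrite bar_to_cpxK.
by rewrite /= cpx_augK.
Qed.

Lemma bar_to_cpx_bar : cancel (@cpx_to_bar R k X) (@bar_to_cpx R k X).
Proof. by move=> c; rewrite cpx_to_barE cpx_augK. Qed.

Lemma cpx_to_bar_cpx : cancel (@bar_to_cpx R k X) (@cpx_to_bar R k X).
Proof. by move=> z; rewrite cpx_to_barE bar_to_cpxK. Qed.

Section TrivialProducts.
Hypothesis cup0 : forall i j (v : cohom i) (w : cohom j),
  reduced v -> reduced w -> cup v w = 0.

(** Each contraction has a product of two reduced classes as an entry, and [cpx_word] is linear in
    that entry. *)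
Lemma contractions_eq0 a e w q : q \in contractions e w -> cpx_word a q.2 = 0.
Proof.
have zero n w1 w2 :
    cpx_word a (w1 ++ Tagged (fun i => Defs.redcohom R k X i)
      (0 : redcohom n) :: w2) = 0.
  have := cpx_word_linearr a w1 w2 (-1) (0 : redcohom n) 0.
  by rewrite /= !scaleN1r !addNr.
(* [pre] collects the entries in front of the contracted pair, for the induction on [w]. *)
suff gen pre : q \in contractions e w -> cpx_word a (pre ++ q.2) = 0.
  exact: (gen [::]).
elim: w e q pre => [//|x [//|y v] IH] e q pre.
rewrite -/(contractions _ (y :: v)) in_cons => /orP[/eqP->|/mapP[q' q'in ->]] /=.
  rewrite /rhelt_mul cup0; [|exact: redcohomP..].
  rewrite (_ : insubd _ _ = 0) ?zero //.
  by apply: val_inj; rewrite insubdK // rpred0.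
by have := IH _ _ (rcons pre x) q'in; rewrite cat_rcons.
Qed.

Lemma bar_cpx_diff0 : @bar_cpx_diff R k X = fun=> 0.
Proof.
apply/funext => c; rewrite /bar_cpx_diff.
elim/(@freeg_ind k bar_gen): (quotrep c) => [|b [a w] D IH].
  by rewrite !linear0.
rewrite !linearP /= [X in _ + X]IH addr0 fglift_fgen /bar_res_diff_gen linearD /=.
rewrite linear_sum big_seq big1 ?addr0 => [|q /(contractions_eq0 a) q0]; last first.
  by rewrite linearZ /= -/(cpx_word _ _) q0 scaler0.
case: w => [|x w]; first by rewrite linear0 scaler0.
(* The leading term has coefficient a x_1, which is reduced and so is divided out in k (x)_A -. *)
rewrite linearZ /= -/(cpx_word _ _) [cpx_word _ _](_ : _ = 0) ?scaler0 //.
by apply: cpx_word_reduced; apply/reduced_cupr/redcohomP.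
Qed.

End TrivialProducts.

End BarComplex.

(** * Tor *)

Section ZeroDifferential.
Context {k : fieldType} (D : dg_hopf_data k).
Hypothesis diff0 : @dg_diff k D = fun=> 0.

Lemma dg_cycles_setT x : @dg_cycles k D x.
Proof. by rewrite /dg_cycles /= diff0. Qed.

Lemma dg_boundaries_set0 : @dg_boundaries k D = [set 0].
Proof.
rewrite /dg_boundaries diff0; apply/seteqP; split=> [_ [x _ <-] //|_ ->].
by exists 0.
Qed.

Lemma dg_class_linear : linear (@dg_class k D).
Proof.
move=> a x y; apply: hclass_linear; try exact: dg_cycles_setT.
by split=> *; exact: dg_cycles_setT.
Qed.

Lemma dg_boundaries_subspace : subspace (@dg_boundaries k D).
Proof.
by rewrite dg_boundaries_set0; split=> // a x y -> ->; rewrite scaler0 addr0.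
Qed.

(** With 0 as the only boundary, a class has a single representative. *)
Lemma hrep_dg_class x : hrep (@dg_class k D x) = x.
Proof.
have e : dg_class (hrep (@dg_class k D x)) = dg_class x by exact: hrepK.
have [/(_ e) + _] := hclass_eqP dg_boundaries_subspace
  (dg_cycles_setT (hrep (@dg_class k D x))) (dg_cycles_setT x).
by case=> y _; rewrite diff0 => /esym/eqP; rewrite subr_eq0 => /eqP.
Qed.

Lemma tens_diff0 : @tens_diff k D = fun=> 0.
Proof.
apply/funext => t; rewrite /tens_diff diff0.
have [/= pl pr] := @pure_bilin k D D.
rewrite (_ : (fun _ _ => _) = fun _ _ => 0); last first.
  apply/funext => x; apply/funext => y.
  by rewrite (linear_fun0 (pl y)) (linear_fun0 (pr _)) addr0.
rewrite /tens_lift; elim/(@freeg_ind k (D * D)%type): (quotrep t) => [|a x E IH].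
  by rewrite linear0.
by rewrite linearP /= IH fglift_fgen scaler0 addr0.
Qed.

(** As the differential of D (x) D vanishes too, the graph defining the coproduct has exactly one
    value. [cl] is [dg_class] bundled with its linearity, which depends on [diff0]. *)
Lemma comul_homology0 (cl : {linear D -> dg_homology D}) (h : dg_homology D) :
  cl =1 @dg_class k D ->
  hopf_comul (homology_hopf D) h = tens_map cl cl (hopf_comul D (hrep h)).
Proof.
move=> clE; have graphE t : comul_homology_graph h t <->
    t = tens_map cl cl (hopf_comul D (hrep h)).
  split=> [[s [_ [t' _]]]|->].
    rewrite tens_diff0 => /esym/eqP; rewrite subr_eq0 => /eqP -> ->.
    by rewrite tens_map_sum_pure; apply: eq_bigr => q _; rewrite !clE.
  have [s sE] := tens_sum_pure (hopf_comul D (hrep h)).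
  exists s; split.
  - by move=> q _; split; exact: dg_cycles_setT.
  - by exists 0 => //; rewrite tens_diff0 sE subrr.
  - rewrite sE tens_map_sum_pure; apply: eq_bigr => q _; by rewrite !clE.
rewrite /homology_hopf /=; case: xgetP => [t _ /graphE //|none].
by case: (none (tens_map cl cl (hopf_comul D (hrep h)))); apply/graphE.
Qed.

End ZeroDifferential.

Section TorBar.
Context {R : realType} {k : fieldType} {X : ptopologicalType}.
Hypothesis cup0 : forall i j (v : cohom R k i X) (w : cohom R k j X),
  reduced v -> reduced w -> cup v w = 0.

Lemma Tor_bar_isomorphic : hopf_isomorphic (Tor_hopf R k X) (bar_hopf R k X).
Proof.
set D := bar_cpx_dg_hopf R k X.
have diff0 : @dg_diff k D = fun=> 0 by exact: bar_cpx_diff0 cup0.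
pose phi (h : Tor_hopf R k X) : bar_hopf R k X := cpx_to_bar (hrep h).
pose psi (z : bar_hopf R k X) : Tor_hopf R k X :=
  @dg_class k D (bar_to_cpx z).
have phiK : cancel phi psi.
  by move=> h; rewrite /psi /phi bar_to_cpx_bar; exact: hrepK.
have psiK : cancel psi phi.
  by move=> z; rewrite /psi /phi hrep_dg_class // cpx_to_bar_cpx.
have phi_class x : phi (@dg_class k D x) = cpx_to_bar x.
  by rewrite /phi hrep_dg_class.
have psi_linear : linear psi.
  by move=> a x y; rewrite /psi linearP; exact: dg_class_linear.
(* [phi] is defined through choices of representatives and inherits linearity from its inverse. *)
have phi_linear : linear phi.
  by move=> a x y; apply: (can_inj psiK); rewrite psi_linear !phiK.
pose lphi : {linear Tor_hopf R k X -> bar_hopf R k X} :=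
  HB.pack phi (GRing.isLinear.Build k _ _ _ phi phi_linear).
pose cl : {linear D -> dg_homology D} :=
  HB.pack (@dg_class k D)
    (GRing.isLinear.Build k _ _ _ _ (dg_class_linear diff0)).
exists lphi; split; first by exists psi.
split.
  move=> s t; apply/seteqP; split=> [_ [_ [_ [[z zst <-] _] <-] <-]|z zst].
    by rewrite /= phi_class cpx_to_bar_cpx.
  exists (psi z); last exact: psiK.
  exists (bar_to_cpx z) => //; split; first by exists z.
  exact: dg_cycles_setT.
split; first by rewrite /= phi_class cpx_to_bar_cpx.
split; first by move=> x y; rewrite /= phi_class cpx_to_bar_cpx.
(* The counit of Tor is by definition that of the bar construction composed with [phi]. *)
split=> [x //|h].
rewrite (comul_homology0 diff0 (cl := cl)) //.
(* Both sides come from [bar_comul (phi h)]; on the right each tensor factor is mapped by [psi] and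
   then by [phi], which is the identity. *)
rewrite [X in tens_map cl cl X]/(tens_map (@bar_to_cpx R k X)
  (@bar_to_cpx R k X) (bar_comul (phi h))) !tens_map_comp.
rewrite -[LHS]tens_map_id.
by congr (tens_map _ _ _); apply/funext => z; rewrite [RHS]psiK.
Qed.

End TorBar.

Theorem theorem2p4 (R : realType) (k : fieldType) (n : nat)
  (S B : topologicalType) (p : continuousType S B)
  (hp : spherical_fibration R n p)
  (hM : simply_connected R (thom_space R p))
  (hB : finite_type_cohom R k B)
  (u : cohom R k n (thom_space R p))
  (hu : orientation_class u)
  (hu2 : cup u u = 0%R) :
  hopf_isomorphic (Tor_hopf R k (thom_space R p))
                  (bar_hopf R k (thom_space R p)).
Proof.
by apply: Tor_bar_isomorphic => i j v w; exact: thom_cup_eq0 hu hu2 i j v w.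
Qed.
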